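(* Let $n\geq 3$, and let $C$ be an oriented simple closed curve disjoint from an embedding of $K_n$ in $\mathbb{R}^3$ such that $C$ links some cycle of $K_n$. Then $C$ weakly links $K_n$ if and only if $C$ links $K_n$ in a star.
   Context: An embedded graph is identified with its image in $\mathbb{R}^3$; a cycle in it is a simple closed curve formed by its edges. $\operatorname{Lk}(C,D)$ denotes the linking number of disjoint oriented simple closed curves. Disjoint simple closed curves $C,D$ are linked if $\operatorname{Lk}(C,D)\neq 0$, and strongly linked if $|\operatorname{Lk}(C,D)|\geq 2$. The curve $C$ weakly links $K_n$ if $C$ links some cycle of $K_n$ but strongly links no cycle of $K_n$. For distinct vertices $p,q,r$, $pqr$ denotes the oriented triangle $p\to q\to r\to p$, and $-T$ is $T$ with reversed orientation. Star: let $(\{p\},O,I)$ be an ordered partition of the vertices of $K_n$ into nonempty sets. The star $pOI$ consists of all oriented triangles $pqr$ with $q\in O$ and $r\in I$. ''$C$ links $K_n$ in the star $pOI$'' means that for all oriented triangles $T$ of $K_n$: $\operatorname{Lk}(C,T)=+1$ if $T$ is a triangle of $pOI$, $\operatorname{Lk}(C,T)=-1$ if $-T$ is a triangle of $pOI$, and $\operatorname{Lk}(C,T)=0$ otherwise. ''$C$ links $K_n$ in a star'' means this holds for some star $pOI$ in $K_n$. *)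

(* Defs.v *)
From HB Require Import structures.
From mathcomp Require Import all_boot all_order all_algebra.
From mathcomp Require Import all_classical all_reals all_analysis.

Set Implicit Arguments.
Unset Strict Implicit.
Unset Printing Implicit Defensive.

Import Order.TTheory GRing.Theory Num.Theory.
Import numFieldNormedType.Exports.

Local Open Scope classical_set_scope.
Local Open Scope ring_scope.

(* An oriented closed curve is given by a parametrization [R -> 'rV[R]_3] of
   which only the values on [0, 1] matter. *)
Definition closed_curve (R : realType) (g : R -> 'rV[R]_3) : Prop :=
  {within `[0, 1], continuous g} /\ g 0 = g 1.

Definition simple_closed_curve (R : realType) (g : R -> 'rV[R]_3) : Prop :=
  closed_curve g /\ {in `[0, 1[ &, injective g}.

Definition segment (R : realType) (V : lmodType R) (e : V * V) (t : R) : V :=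
  (1 - t) *: e.1 + t *: e.2.

(** ** Linking number

   The linking number of two disjoint polygonal loops P and Q is the sum of
   the signs of the crossings of P over Q in any regular projection.  For two
   disjoint continuous loops it is the linking number of any sufficiently fine
   pair of inscribed polygons: once these are closer to the loops than half
   the distance between the loops, the straight-line homotopies to the
   polygons keep the two loops disjoint. *)

(* Edges (ordered pairs of consecutive vertices) of the polygon inscribed in
   [g] with vertices [g 0] and [g x] for x in s. *)
Definition inscribed (R : realType) (g : R -> 'rV[R]_3) (s : seq R) :
    seq ('rV[R]_3 * 'rV[R]_3) :=
  pairmap (fun x y => (g x, g y)) 0 s.

Definition det3 (R : realType) (a b c : 'rV[R]_3) : R :=
  \det (\matrix_(i < 3) nth 0 [:: a; b; c] i).

(* The images of the edges [e] and [e'] under the projection along [v] meet at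
   most in a transverse double point interior to both. *)
Definition regular_pair (R : realType) (v : 'rV[R]_3)
    (e e' : 'rV[R]_3 * 'rV[R]_3) : Prop :=
  forall s t h : R, 0 <= s <= 1 -> 0 <= t <= 1 ->
    segment e s = segment e' t + h *: v ->
    [/\ 0 < s < 1, 0 < t < 1 & det3 (e.2 - e.1) (e'.2 - e'.1) v != 0].

Definition regular_projection (R : realType) (v : 'rV[R]_3)
    (P Q : seq ('rV[R]_3 * 'rV[R]_3)) : Prop :=
  v != 0 /\ forall e e', e \in P -> e' \in Q -> regular_pair v e e'.

(* [v] points upwards; for upper strand u and lower strand w, the crossing is
   right-handed (positive) iff (u x w) . v > 0. *)
Definition crossing_sign (R : realType) (v : 'rV[R]_3)
    (e e' : 'rV[R]_3 * 'rV[R]_3) : int :=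
  if `[< exists s t h : R, [/\ 0 < s < 1, 0 < t < 1, 0 < h &
           segment e s = segment e' t + h *: v] >]
  then sgz (det3 (e.2 - e.1) (e'.2 - e'.1) v) else 0.

Definition crossing_number (R : realType) (v : 'rV[R]_3)
    (P Q : seq ('rV[R]_3 * 'rV[R]_3)) : int :=
  \sum_(e <- P) \sum_(e' <- Q) crossing_sign v e e'.

Definition fine_partition (R : realType) (eta : R) (s : seq R) : Prop :=
  itv_partition 0 1 s /\ path (fun x y => y - x < eta) 0 s.

Definition is_linking_number (R : realType) (g d : R -> 'rV[R]_3) (k : int) :
    Prop :=
  exists2 eta : R, 0 < eta & forall s t (v : 'rV[R]_3),
    fine_partition eta s -> fine_partition eta t ->
    regular_projection v (inscribed g s) (inscribed d t) ->
    crossing_number v (inscribed g s) (inscribed d t) = k.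

(* The default value 0 is never used for disjoint closed curves: there
   [is_linking_number g d] holds of exactly one integer. *)
Definition Lk (R : realType) (g d : R -> 'rV[R]_3) : int :=
  xget 0 [set k | is_linking_number g d k].

Definition linked (R : realType) (g d : R -> 'rV[R]_3) : Prop :=
  Lk g d != 0.

Definition strongly_linked (R : realType) (g d : R -> 'rV[R]_3) : Prop :=
  2 <= `|Lk g d|.

(** ** Embedded complete graphs *)

(* The i-th vertex of the geometric realization of K_n is the i-th standard
   basis vector of R^n. *)
Definition Kn_vertex (R : realType) (n : nat) (i : 'I_n) : 'rV[R]_n :=
  delta_mx 0 i.

Definition Kn_edge (R : realType) (n : nat) (i j : 'I_n) (t : R) : 'rV[R]_n :=
  segment (Kn_vertex R i, Kn_vertex R j) t.

(* The 1-skeleton of the standard simplex; i = j only contributes the i-th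
   vertex. *)
Definition Kn (R : realType) (n : nat) : set 'rV[R]_n :=
  \bigcup_i \bigcup_j (@Kn_edge R n i j @` `[0, 1]).
Arguments Kn R n : clear implicits.

(* As Kn is compact, a continuous injection is a topological embedding. *)
Definition Kn_embedding (R : realType) (n : nat) (f : 'rV[R]_n -> 'rV[R]_3) :
    Prop :=
  {within Kn R n, continuous f} /\ {in Kn R n &, injective f}.

(* An oriented cycle is the list of its distinct vertices in cyclic order. *)
Definition is_cycle (n : nat) (c : seq 'I_n) : Prop :=
  (3 <= size c)%N /\ uniq c.

(* Concatenation of the paths in [es], each run through at constant speed in
   time 1 / size es.  The modulus only matters at t = 1, where it returns the
   initial point of the first path. *)
Definition concat_loop (R : realType) (es : seq (R -> 'rV[R]_3)) (t : R) :
    'rV[R]_3 :=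
  let u := (size es)%:R * t in
  let i := Num.truncn u in
  nth (fun=> 0) es (i %% size es) (u - i%:R).

Definition cycle_curve (R : realType) (n : nat) (f : 'rV[R]_n -> 'rV[R]_3)
    (c : seq 'I_n) : R -> 'rV[R]_3 :=
  concat_loop [seq f \o @Kn_edge R n i (next c i) | i <- c].

Definition links_some_cycle (R : realType) (n : nat)
    (f : 'rV[R]_n -> 'rV[R]_3) (C : R -> 'rV[R]_3) : Prop :=
  exists2 c : seq 'I_n, is_cycle c & linked C (cycle_curve f c).

Definition weakly_links (R : realType) (n : nat)
    (f : 'rV[R]_n -> 'rV[R]_3) (C : R -> 'rV[R]_3) : Prop :=
  links_some_cycle f C /\
  forall c : seq 'I_n, is_cycle c -> ~ strongly_linked C (cycle_curve f c).

(** ** Stars *)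

Definition is_star (n : nat) (p : 'I_n) (O I : {set 'I_n}) : Prop :=
  [/\ (0 < #|O|)%N, (0 < #|I|)%N, O :&: I = finset.set0 & O :|: I = finset.setC [set p]].

(* The list T represents an oriented triangle up to rotation. *)
Definition in_star (n : nat) (p : 'I_n) (O I : {set 'I_n}) (T : seq 'I_n) :
    Prop :=
  exists q r k, [/\ q \in O, r \in I & T = rot k [:: p; q; r]].

Definition links_in_the_star (R : realType) (n : nat)
    (f : 'rV[R]_n -> 'rV[R]_3) (C : R -> 'rV[R]_3)
    (p : 'I_n) (O I : {set 'I_n}) : Prop :=
  forall T : seq 'I_n, size T = 3%N -> uniq T ->
    [/\ in_star p O I T -> Lk C (cycle_curve f T) = 1,
        in_star p O I (rev T) -> Lk C (cycle_curve f T) = -1 &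
        ~ in_star p O I T -> ~ in_star p O I (rev T) ->
          Lk C (cycle_curve f T) = 0].

Definition links_in_a_star (R : realType) (n : nat)
    (f : 'rV[R]_n -> 'rV[R]_3) (C : R -> 'rV[R]_3) : Prop :=
  exists p O I, is_star p O I /\ links_in_the_star f C p O I.

(* Main.v *)
(* For fixed partitions of [C] and of the edges of K_n and a fixed generic
   direction, the crossing number of [C] with an oriented cycle is a sum of
   contributions of its oriented edges.  Hence, once crossing numbers are known
   to compute linking numbers, [Lk C] on cycles is given by an antisymmetric
   integer cochain [W] on the edges, and the theorem becomes a statement about
   integer cochains on K_n.

   Invariance of crossing numbers rests on one principle: in a two-dimensional
   space of linear dependences among six vectors, the nonnegative ones form a
   planar cone, which is {0} or has exactly two boundary rays, and these carry
   opposite signs.  With three points of one polygon, two of the other and one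
   direction, this says how a crossing changes across a triangle; with two points
   of each polygon and two directions, how it changes with the direction.  In
   both cases the defect telescopes around the closed polygons.

   For the combinatorics, normalise the cochain to vanish on the edges at a vertex
   [p] of a linked triangle.  Cycles of length 4 through [p] show that no edge of
   value 1 follows another one, cycles of length 5 that the edges of value 1 form a
   complete bipartite graph from [O] to [I], and cycles of length 6 that, if some
   other vertex is in neither part, then [O] or [I] is a singleton; in each case a
   star results, with apex [p] or that singleton.  Conversely a star cochain
   agrees with a coboundary of an indicator function away from its apex. *)
Require Import Defs.
From mathcomp Require Import all_boot all_order all_algebra.
From mathcomp Require Import all_classical all_reals all_analysis.
From mathcomp Require Import ring lra zify.
Set Implicit Arguments.
Unset Strict Implicit.
Unset Printing Implicit Defensive.
Import Order.TTheory GRing.Theory Num.Theory.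
Import numFieldNormedType.Exports.
Local Open Scope classical_set_scope.
Local Open Scope ring_scope.

(** * Facets of a planar family of dependences *)

Section Balance.
Variables (R : realType) (I : finType) (L : (I -> R) -> Prop) (x psi : I -> R).

Let w (c : I -> R) : R := \sum_i x i * c i.

Definition feasible (c : I -> R) : Prop := [/\ L c, forall i, 0 <= c i & 0 < w c].

Hypothesis L_lin : forall (a b : R) c d, L c -> L d ->
  L (fun i => a * c i + b * d i).
Hypothesis w_eq0 : forall c, L c -> (forall i, 0 <= c i) -> w c = 0 ->
  forall i, c i = 0.
Hypothesis one_zero : forall c i j, feasible c -> c i = 0 -> c j = 0 -> i = j.
Hypothesis L_psi : L psi.
Hypothesis w_psi : w psi = 0.

Let wD a b c d : w (fun i => a * c i + b * d i) = a * w c + b * w d.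
Proof.
rewrite /w !mulr_sumr -big_split; apply: eq_bigr => i _.
by rewrite mulrDr (mulrCA (x i) a) (mulrCA (x i) b).
Qed.

(** Ratio test: moving along [y] keeps the weight, and the smallest ratio [c i / - y i] over the
    negative entries of [y] is the time at which a first coordinate vanishes. *)
Let exit c y j : feasible c -> L y -> w y = 0 -> y j < 0 ->
  exists (t : R) (k : I), [/\ y k < 0, feasible (fun i => 1 * c i + t * y i) &
    1 * c k + t * y k = 0].
Proof.
move=> [Lc c0 wc] Ly wy yj.
have [k /= yk kmin] := @arg_minP _ _ _ j (fun i => y i < 0)
  (fun i => c i / - y i) yj.
exists (c k / - y k), k; split => //; last first.
  by rewrite mul1r -mulrA invrN mulNr mulVf ?ltr0_neq0// mulrN1 subrr.
split; [exact: L_lin | | by rewrite wD wy mulr0 addr0 mul1r].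
move=> i; rewrite mul1r; have [yi|yi] := ltP (y i) 0.
  have := kmin _ yi; rewrite ler_pdivlMr ?oppr_gt0// mulrN.
  by rewrite -subr_ge0 opprK.
by rewrite addr_ge0// mulr_ge0// divr_ge0// oppr_ge0 ltW.
Qed.

Let neg_entry y : L y -> w y = 0 -> (exists i, y i != 0) -> exists j, y j < 0.
Proof.
move=> Ly wy [i yi]; apply/not_existsP => h.
move: yi; rewrite (w_eq0 Ly _ wy) ?eqxx// => k.
by rewrite leNgt; apply/negP/h.
Qed.

(** Here [one_zero] forces dimension two: if [d] were nonzero, moving from [c] along [d] would reach
    a zero at some [l] with [d l < 0] while keeping the zero at [k]. *)
Let zero c d k : feasible c -> L d -> c k = 0 -> d k = 0 -> w d = 0 ->
  forall i, d i = 0.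
Proof.
move=> fc Ld ck dk wd i; apply/eqP/negPn/negP => di.
have [j dj] : exists j, d j < 0 by apply: neg_entry => //; exists i.
have [t [l [dl fe el]]] := exit fc Ld wd dj.
have kl : k = l by apply: one_zero fe _ el; rewrite ck dk !mulr0 addr0.
by move: dl; rewrite -kl dk ltxx.
Qed.

Definition facet (i : I) : Prop := exists2 c, feasible c & c i = 0.

(** For distinct [k] and [l], a weight-zero combination of the two facet points is corrected by
    [psi] to vanish at [k]. By [zero] it vanishes everywhere, yet its value at [l] is a sum of two
    negative terms. *)
Lemma facet_uniq k l : facet k -> facet l -> psi k < 0 -> psi l < 0 -> k = l.
Proof.
move=> [c fc ck] [d fd dl] pk pl.
have [//|/eqP kl] := eqVneq k l.
have [Lc c0 wc] := fc; have [Ld d0 wd] := fd.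
have dk : 0 < d k.
  by rewrite lt_neqAle d0 andbT; apply/eqP => /esym/(one_zero fd)/(_ dl)/kl.
have cl : 0 < c l.
  by rewrite lt_neqAle c0 andbT; apply/eqP => /esym/(one_zero fc ck)/kl.
pose z i := w c * d i + (- w d) * c i.
have Lz : L z by exact: L_lin.
pose y i := 1 * z i + (- (w c * d k / psi k)) * psi i.
have Ly : L y by exact: L_lin.
have wy : w y = 0.
  by rewrite wD w_psi mulr0 addr0 mul1r /z wD mulNr mulrC subrr.
have yk : y k = 0.
  rewrite /y /z ck mulr0 addr0 mul1r mulNr mulfVK ?subrr//.
  exact: ltr0_neq0.
have /(_ l) := zero fc Ly ck yk wy.
rewrite /y /z dl mulr0 add0r mul1r => yl; exfalso.
have : 0 < w d * c l + w c * d k / psi k * psi l; last lra.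
apply: addr_gt0; first exact: mulr_gt0.
rewrite -mulrA; apply: mulr_gt0; first exact: mulr_gt0.
by rewrite nmulr_rgt0// invr_lt0.
Qed.

(** Moving from the given facet along [psi] stops at a coordinate that decreases to 0. *)
Lemma facet_opp i : facet i -> 0 < psi i -> exists2 k, facet k & psi k < 0.
Proof.
move=> [c fc ci] pi.
have [j pj] : exists j, psi j < 0.
  by apply: neg_entry => //; exists i; rewrite gt_eqF.
have [t [k [pk fk ek]]] := exit fc L_psi w_psi pj.
by exists k => //; exists (fun i => 1 * c i + t * psi i).
Qed.

End Balance.

(* On the slice of weight 1 the nonnegative elements of [L] form a segment with
   direction [psi]; each end lies on exactly one facet, and the sign of [psi]
   there tells the two ends apart. *)
Lemma balanced (R : realType) (I : finType) (L : (I -> R) -> Prop)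
    (x psi : I -> R) :
  (forall (a b : R) c d, L c -> L d -> L (fun i => a * c i + b * d i)) ->
  (forall c, L c -> (forall i, 0 <= c i) -> \sum_i x i * c i = 0 ->
    forall i, c i = 0) ->
  (forall c i j, feasible L x c -> c i = 0 -> c j = 0 -> i = j) ->
  L psi -> \sum_i x i * psi i = 0 ->
  \sum_i (if `[< facet L x i >] then sgz (psi i) else 0) = 0.
Proof.
move=> Llin w0 one Lpsi wpsi.
(* Negating [psi] exchanges the two ends; the combination has the shape required by the linearity
   hypothesis. *)
pose npsi i := 0 * psi i + (-1) * psi i.
have npsiE i : npsi i = - psi i by rewrite /npsi mul0r add0r mulN1r.
have Lnpsi : L npsi by exact: Llin.
have wnpsi : \sum_i x i * npsi i = 0.
  rewrite (eq_bigr (fun i => - (x i * psi i))) ?sumrN ?wpsi ?oppr0// => i _.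
  by rewrite npsiE mulrN.
have U := @facet_uniq _ _ _ _ _ Llin w0 one Lpsi wpsi.
have U' k l : facet L x k -> facet L x l -> 0 < psi k -> 0 < psi l -> k = l.
  move=> fk fl pk pl; apply: (facet_uniq Llin w0 one Lnpsi wnpsi fk fl);
  by rewrite npsiE oppr_lt0.
have O := facet_opp Llin w0 Lpsi wpsi.
have O' i : facet L x i -> psi i < 0 -> exists2 k, facet L x k & 0 < psi k.
  move=> fi pi; have := facet_opp Llin w0 Lnpsi wnpsi fi.
  rewrite npsiE oppr_gt0 => /(_ pi)[k fk].
  by rewrite npsiE oppr_lt0; exists k.
pose s i := if `[< facet L x i >] then sgz (psi i) else 0.
(* By uniqueness only [k] and [l] contribute, with opposite signs. *)
have s0 k l : facet L x k -> psi k < 0 -> facet L x l -> 0 < psi l ->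
    \sum_i s i = 0.
  move=> fk pk fl pl; have kl : k != l.
    by apply/eqP => kl; move: pk; rewrite kl ltNge (ltW pl).
  rewrite (bigD1 k)//= (bigD1 l) 1?eq_sym//= big1 ?addr0.
    rewrite /s !asboolT// ltr0_sgz// gtr0_sgz//.
  move=> i /andP[ik il]; rewrite /s; case: asboolP => // fi.
  case: (ltgtP (psi i) 0) => [pi|pi|->]; last by rewrite sgz0.
    by rewrite (U i k)// eqxx in ik.
  by rewrite (U' i l)// eqxx in il.
have [[k fk pk]|nk] := pselect (exists2 k, facet L x k & psi k != 0).
  case: (ltgtP (psi k) 0) pk => // pk _.
    by have [l fl pl] := O' _ fk pk; exact: s0 pk _ pl.
  by have [l fl pl] := O _ fk pk; exact: s0 pl _ pk.
rewrite big1// => i _; case: asboolP => // fi.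
have [->|pi] := eqVneq (psi i) 0; first by rewrite sgz0.
by exfalso; apply: nk; exists i.
Qed.

(** * Determinants in dimension three *)

Local Notation o0 := (@Ordinal 6 0 isT).
Local Notation o1 := (@Ordinal 6 1 isT).
Local Notation o2 := (@Ordinal 6 2 isT).
Local Notation o3 := (@Ordinal 6 3 isT).
Local Notation o4 := (@Ordinal 6 4 isT).
Local Notation o5 := (@Ordinal 6 5 isT).

Lemma ord6_ind (P : 'I_6 -> Prop) :
  P o0 -> P o1 -> P o2 -> P o3 -> P o4 -> P o5 -> forall i, P i.
Proof.
move=> p0 p1 p2 p3 p4 p5 [[|[|[|[|[|[|i]]]]]] hi] //;
  by rewrite (bool_irrelevance hi isT).
Qed.

Lemma ord3_ind (P : 'I_3 -> Prop) :
  P (@Ordinal 3 0 isT) -> P (@Ordinal 3 1 isT) -> P (@Ordinal 3 2 isT) ->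
  forall i, P i.
Proof.
move=> p0 p1 p2 [[|[|[|i]]] hi] //;
  by rewrite (bool_irrelevance hi isT).
Qed.

Lemma sum6 (V : nmodType) (F : 'I_6 -> V) :
  \sum_(i < 6) F i = F o0 + F o1 + F o2 + F o3 + F o4 + F o5.
Proof.
rewrite !big_ord_recl big_ord0 addr0 !addrA.
by do !congr (_ + _); congr F; exact/val_inj.
Qed.

Section Det3.
Variable R : realType.
Implicit Types a b c d v : 'rV[R]_3.

Lemma det3E a b c : let k0 := @Ordinal 3 0 isT in let k1 := @Ordinal 3 1 isT in
  let k2 := @Ordinal 3 2 isT in
  det3 a b c = a 0 k0 * (b 0 k1 * c 0 k2 - b 0 k2 * c 0 k1)
             - a 0 k1 * (b 0 k0 * c 0 k2 - b 0 k2 * c 0 k0)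
             + a 0 k2 * (b 0 k0 * c 0 k1 - b 0 k1 * c 0 k0).
Proof.
move=> k0 k1 k2; rewrite /det3 (expand_det_row _ ord0) !big_ord_recl big_ord0.
rewrite /cofactor !(expand_det_row _ ord0) !big_ord_recl !big_ord0.
rewrite /cofactor !det_mx11 !mxE /=.
(* Entries are indexed by natural numbers, so that [ring] identifies ordinals differing only in
   their proofs. *)
pose g (x : 'rV[R]_3) (m : nat) : R := x 0 (@inord 2 m).
have E (x : 'rV[R]_3) (i : 'I_3) : x 0 i = g x i by rewrite /g inord_val.
rewrite !E /= /bump /= !exprS !expr0; ring.
Qed.

(** The universal relation among four vectors in dimension three; its coefficients supply the
    dependence [psi] for both kinds of move. *)
Lemma cramer a b c d : det3 b c d *: a - det3 a c d *: b + det3 a b d *: c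
  - det3 a b c *: d = 0.
Proof.
by apply/rowP; elim/ord3_ind; rewrite !mxE !det3E; ring.
Qed.
End Det3.

(** * Crossings as positive dependences *)

Section Dependence.
Variable R : realType.
Local Notation V := 'rV[R]_3.

(** In the uses, [k i] is 1 or -1 for a point of one polygon or the other and 0 for a direction, so
    the first equation says that both sides carry the same mass. *)
Definition dependence (I : finType) (k : I -> R) (u : I -> V) (c : I -> R) :=
  \sum_i k i * c i = 0 /\ \sum_i c i *: u i = 0.

Lemma dependence_lin (I : finType) (k : I -> R) (u : I -> V) (a b : R) c d :
  dependence k u c -> dependence k u d ->
  dependence k u (fun i => a * c i + b * d i).
Proof.
move=> [c0 cu] [d0 du]; split.
  under eq_bigr do rewrite mulrDr (mulrCA _ a) (mulrCA _ b).
  by rewrite big_split/= -!mulr_sumr c0 d0 !mulr0 addr0.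
under eq_bigr do rewrite scalerDl -!scalerA.
by rewrite big_split/= -!scaler_sumr cu du !scaler0 addr0.
Qed.

Definition six (T : Type) (x0 x1 x2 x3 x4 x5 : T) (i : 'I_6) : T :=
  nth x0 [:: x0; x1; x2; x3; x4; x5] i.

Definition disjoint_edges (e e' : V * V) := forall s t : R,
  0 <= s <= 1 -> 0 <= t <= 1 -> segment e s <> segment e' t.

(* Homogeneous form of [segment e s = segment e' t + h *: v]. *)
Definition crosses (v : V) (e e' : V * V) := exists a0 a1 b0 b1 h : R,
  [/\ [/\ 0 <= a0, 0 <= a1, 0 <= b0, 0 <= b1 & 0 <= h], 0 < a0 + a1,
      a0 + a1 = b0 + b1 &
      a0 *: e.1 + a1 *: e.2 = b0 *: e'.1 + b1 *: e'.2 + h *: v].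

Definition noncoplanar (v x y : V) := forall a b : R, v <> a *: x + b *: y.

Lemma noncoplanarP v x y (h a b : R) : noncoplanar v x y -> h != 0 ->
  h *: v <> a *: x + b *: y.
Proof.
move=> g h0 e; apply: (g (a / h) (b / h)).
by rewrite ![_ / h]mulrC -!scalerA -scalerDr -e scalerA mulVf// scale1r.
Qed.

(** Dividing by the total mass gives segment parameters; the height is not 0 because the edges are
    disjoint. *)
Lemma crosses_gt0 v e e' (a0 a1 b0 b1 h : R) : disjoint_edges e e' ->
  0 <= a0 -> 0 <= a1 -> 0 <= b0 -> 0 <= b1 -> 0 <= h -> 0 < a0 + a1 ->
  a0 + a1 = b0 + b1 ->
  a0 *: e.1 + a1 *: e.2 = b0 *: e'.1 + b1 *: e'.2 + h *: v -> 
  [/\ 0 <= a1 / (a0 + a1) <= 1, 0 <= b1 / (a0 + a1) <= 1, 0 < h / (a0 + a1) &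
    segment e (a1 / (a0 + a1)) = segment e' (b1 / (a0 + a1)) + (h / (a0 + a1)) *: v].
Proof.
move=> de a00 a10 b00 b10 h0 m0 ab eq; set m := a0 + a1 in m0 ab *.
have mn0 : m != 0 by rewrite gt_eqF.
have A : 0 <= a1 / m <= 1.
  by rewrite (divr_ge0 _ (ltW m0))//= ler_pdivrMr// mul1r /m lerDr.
have B : 0 <= b1 / m <= 1.
  by rewrite (divr_ge0 _ (ltW m0))//= ler_pdivrMr// mul1r ab lerDr.
have E : segment e (a1 / m) = segment e' (b1 / m) + (h / m) *: v.
  suff key x y z : a1 = x * m -> b1 = y * m -> h = z * m ->
    segment e x = segment e' y + z *: v by apply: key; rewrite mulfVK.
  move=> a1E b1E hE.
  have a0E : a0 = m - x * m by rewrite -a1E /m addrK.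
  have b0E : b0 = m - y * m by rewrite -b1E ab addrK.
  rewrite /segment; apply/rowP => i; move/rowP/(_ i): eq; rewrite !mxE.
  rewrite a0E b0E a1E b1E hE => eq.
  apply: (mulIf mn0); lra.
split=> //; rewrite divr_gt0// lt_neqAle h0 andbT; apply/eqP => h00.
by apply: (de _ _ A B); rewrite E -h00 mul0r scale0r addr0.
Qed.

(** The weak inequalities of [crosses] suffice: regularity makes the parameters interior and
    disjointness makes the height positive. *)
Lemma crossing_signE v e e' : disjoint_edges e e' -> regular_pair v e e' ->
  crossing_sign v e e' =
  if `[< crosses v e e' >] then sgz (det3 (e.2 - e.1) (e'.2 - e'.1) v) else 0.
Proof.
move=> de re; rewrite /crossing_sign; congr (if _ then _ else _).
apply/asbool_equiv_eq; split.
  move=> [s [t [h [/andP[s0 s1] /andP[t0 t1] h0 eq]]]].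
  exists (1 - s), s, (1 - t), t, h; split => //; rewrite ?subrK//.
  by split; lra.
move=> [a0 [a1 [b0 [b1 [h [[a00 a10 b00 b10 h0] m0 ab eq]]]]]].
have [A B H E] := crosses_gt0 de a00 a10 b00 b10 h0 m0 ab eq.
have [A' B' _] := re _ _ _ A B E.
by exists (a1 / (a0 + a1)), (b1 / (a0 + a1)), (h / (a0 + a1)).
Qed.

Lemma crosses_boundary v e e' (a0 a1 b0 b1 h : R) : disjoint_edges e e' ->
  regular_pair v e e' ->
  0 <= a0 -> 0 <= a1 -> 0 <= b0 -> 0 <= b1 -> 0 <= h -> 0 < a0 + a1 ->
  a0 + a1 = b0 + b1 ->
  a0 *: e.1 + a1 *: e.2 = b0 *: e'.1 + b1 *: e'.2 + h *: v ->
  [/\ 0 < a0, 0 < a1, 0 < b0, 0 < b1 & 0 < h].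
Proof.
move=> de re a00 a10 b00 b10 h0 m0 ab eq.
have [A B H E] := crosses_gt0 de a00 a10 b00 b10 h0 m0 ab eq.
have [/andP[]] := re _ _ _ A B E.
rewrite pmulr_lgt0 ?invr_gt0// ltr_pdivrMr// mul1r => a1p a0p.
rewrite pmulr_lgt0 ?invr_gt0// ltr_pdivrMr// mul1r => /andP[b1p b0p] _.
move: H; rewrite pmulr_lgt0 ?invr_gt0// => hp.
split => //; lra.
Qed.

End Dependence.

(** * Relations among three points and a direction *)

Section CoplanarCases.
Variables (R : realType) (v : 'rV[R]_3).
Implicit Types p z : 'rV[R]_3.

Lemma edge_over_point p p' z (h r s t : R) : h != 0 ->
  noncoplanar v (p - z) (p' - z) -> r + s = t ->
  r *: p + s *: p' = t *: z + h *: v -> False.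
Proof.
move=> h0 g e1 e2; apply: (noncoplanarP (a := r) (b := s) g h0).
apply/rowP => i; move/rowP/(_ i): e2; rewrite -e1 !mxE; lra.
Qed.

Lemma point_over_edge p z z' (h r s t : R) : h != 0 ->
  noncoplanar v (p - z) (p - z') -> t = r + s ->
  t *: p = r *: z + s *: z' + h *: v -> False.
Proof.
move=> h0 g e1 e2; apply: (noncoplanarP (a := r) (b := s) g h0).
apply/rowP => i; move/rowP/(_ i): e2; rewrite e1 !mxE; lra.
Qed.

End CoplanarCases.

(** * Change of crossings across a triangle *)

Section TriangleMove.
Variables (R : realType) (v a b c q q' : 'rV[R]_3).
Local Notation V := 'rV[R]_3.

(** The triangle has a point above [z] in the direction [v], in homogeneous form as for
    [crosses]. *)
Definition above_triangle (z : V) := exists x0 x1 x2 h : R,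
  [/\ [/\ 0 <= x0, 0 <= x1, 0 <= x2 & 0 <= h], 0 < x0 + x1 + x2 &
    x0 *: a + x1 *: b + x2 *: c = (x0 + x1 + x2) *: z + h *: v].

(** The intersection sign of the triangle with the ray from [z] in the direction [v]. *)
Definition triangle_hit (z : V) : int :=
  if `[< above_triangle z >] then sgz (det3 (b - a) (c - a) v) else 0.

Definition triangle_misses (e : V * V) := forall x0 x1 x2 t : R,
  0 <= x0 -> 0 <= x1 -> 0 <= x2 -> x0 + x1 + x2 = 1 -> 0 <= t <= 1 ->
  x0 *: a + x1 *: b + x2 *: c <> segment e t.

(** The dependences place a point of the triangle over a point of the edge; [x] measures the mass on
    the triangle. *)
Let k : 'I_6 -> R := six 1 1 1 (-1) (-1) 0.
Let u : 'I_6 -> V := six a b c (- q) (- q') (- v).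
Let x : 'I_6 -> R := six 1 1 1 0 0 0.

Let depE f : dependence k u f <-> f o0 + f o1 + f o2 = f o3 + f o4 /\
  f o0 *: a + f o1 *: b + f o2 *: c = f o3 *: q + f o4 *: q' + f o5 *: v.
Proof.
rewrite /dependence !sum6 /k /u /six /= !scalerN.
split=> -[e1 /eqP e2]; (split; first lra); apply/eqP; move: e2.
  by rewrite -!addrA -!opprD !addrA subr_eq0 ?addrA => /eqP ->.
by rewrite -!addrA -!opprD !addrA subr_eq0 ?addrA => /eqP ->.
Qed.

Let wE f : \sum_i x i * f i = f o0 + f o1 + f o2.
Proof. by rewrite sum6 /x /six /= !mul1r !mul0r !addr0. Qed.

Let feasE f : feasible (dependence k u) x f <->
  [/\ [/\ 0 <= f o0, 0 <= f o1, 0 <= f o2, 0 <= f o3 & 0 <= f o4] /\ 0 <= f o5,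
   0 < f o0 + f o1 + f o2, f o0 + f o1 + f o2 = f o3 + f o4 &
   f o0 *: a + f o1 *: b + f o2 *: c = f o3 *: q + f o4 *: q' + f o5 *: v].
Proof.
split=> [[/depE[e1 e2] f0]|]; first by rewrite wE.
move=> [[[p0 p1 p2 p3 p4] p5] w0 e1 e2]; split; first exact/depE.
  by elim/ord6_ind.
by rewrite wE.
Qed.

(** Dropping a vertex of the triangle leaves its opposite side crossing over the edge; dropping an
    end of the edge leaves the triangle above the other end. *)
Let facet0 : facet (dependence k u) x o0 <-> crosses v (b, c) (q, q').
Proof.
split=> [[f /feasE[[[p0 p1 p2 p3 p4] p5]]]|].
  move=> + + + f0; rewrite f0 scale0r !add0r => w0 e1 e2.
  by exists (f o1), (f o2), (f o3), (f o4), (f o5).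
move=> [a0 [a1 [b0 [b1 [h [[? ? ? ? ?] m0 ab eq]]]]]].
by exists (six 0 a0 a1 b0 b1 h) => //; apply/feasE; rewrite scale0r !add0r.
Qed.

Let facet1 : facet (dependence k u) x o1 <-> crosses v (a, c) (q, q').
Proof.
split=> [[f /feasE[[[p0 p1 p2 p3 p4] p5]]]|].
  move=> + + + f0; rewrite f0 scale0r !addr0 => w0 e1 e2.
  by exists (f o0), (f o2), (f o3), (f o4), (f o5).
move=> [a0 [a1 [b0 [b1 [h [[? ? ? ? ?] m0 ab eq]]]]]].
by exists (six a0 0 a1 b0 b1 h) => //; apply/feasE; rewrite scale0r !addr0.
Qed.

Let facet2 : facet (dependence k u) x o2 <-> crosses v (a, b) (q, q').
Proof.
split=> [[f /feasE[[[p0 p1 p2 p3 p4] p5]]]|].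
  move=> + + + f0; rewrite f0 scale0r !addr0 => w0 e1 e2.
  by exists (f o0), (f o1), (f o3), (f o4), (f o5).
move=> [a0 [a1 [b0 [b1 [h [[? ? ? ? ?] m0 ab eq]]]]]].
by exists (six a0 a1 0 b0 b1 h) => //; apply/feasE; rewrite scale0r !addr0.
Qed.

Let facet3 : facet (dependence k u) x o3 <-> above_triangle q'.
Proof.
split=> [[f /feasE[[[p0 p1 p2 p3 p4] p5]]]|].
  move=> + + + f0; rewrite f0 scale0r !add0r => w0 e1 e2.
  by exists (f o0), (f o1), (f o2), (f o5); rewrite -e1 in e2.
move=> [x0 [x1 [x2 [h [[? ? ? ?] m0 eq]]]]].
exists (six x0 x1 x2 0 (x0 + x1 + x2) h) => //; apply/feasE.
by rewrite scale0r !add0r; split => //; split => //; split => //; exact: ltW.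
Qed.

Let facet4 : facet (dependence k u) x o4 <-> above_triangle q.
Proof.
split=> [[f /feasE[[[p0 p1 p2 p3 p4] p5]]]|].
  move=> + + + f0; rewrite f0 scale0r !addr0 => w0 e1 e2.
  by exists (f o0), (f o1), (f o2), (f o5); rewrite -e1 in e2.
move=> [x0 [x1 [x2 [h [[? ? ? ?] m0 eq]]]]].
exists (six x0 x1 x2 (x0 + x1 + x2) 0 h) => //; apply/feasE.
by rewrite scale0r !addr0; split => //; split => //; split => //; exact: ltW.
Qed.

Hypothesis v0 : v != 0.
Hypothesis miss : triangle_misses (q, q').
Hypothesis gen_edge : forall z, z \in [:: q; q'] ->
  [/\ noncoplanar v (a - z) (b - z), noncoplanar v (b - z) (c - z) &
      noncoplanar v (a - z) (c - z)].
Hypothesis gen_vertex : forall p, p \in [:: a; b; c] ->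
  noncoplanar v (p - q) (p - q').

(** At height 0 the triangle would meet the edge. Hence the sixth facet is empty. *)
Let feas_gt0 f : feasible (dependence k u) x f -> 0 < f o5.
Proof.
move=> /feasE[[[p0 p1 p2 p3 p4] p5] w0 e1 e2].
rewrite lt_neqAle p5 andbT; apply/eqP => f5.
set m := f o0 + f o1 + f o2 in w0 e1.
apply: (@miss (f o0 / m) (f o1 / m) (f o2 / m) (f o4 / m));
  rewrite ?divr_ge0 ?(ltW w0)//.
- by rewrite -!mulrDl divff// gt_eqF.
- by rewrite /= ler_pdivrMr// mul1r e1 lerDr.
rewrite ![_ / m]mulrC -!scalerA -!scalerDr e2 -f5 scale0r addr0 /segment /=.
have -> : 1 - m^-1 * f o4 = m^-1 * f o3.
  by apply: (mulfI (lt0r_neq0 w0)); rewrite mulrBr !mulVKf ?gt_eqF// e1; lra.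
by rewrite -!scalerA -scalerDr.
Qed.

(** Two zeros leave a side over a point or a vertex over the edge, both excluded by genericity, or
    else no mass or no height. *)
Let one_zero f i j : feasible (dependence k u) x f -> f i = 0 -> f j = 0 -> i = j.
Proof.
move=> ff; have f5 := feas_gt0 ff; move: ff => /feasE[_ w0 e1 e2].
have f5n : f o5 != 0 by rewrite gt_eqF.
have [gab gbc gac] := gen_edge (mem_head q [:: q']).
have [gab' gbc' gac'] : [/\ noncoplanar v (a - q') (b - q'),
    noncoplanar v (b - q') (c - q') & noncoplanar v (a - q') (c - q')].
  by apply: gen_edge; rewrite !inE eqxx orbT.
have ga : noncoplanar v (a - q) (a - q') by apply: gen_vertex; rewrite !inE eqxx.
have gb : noncoplanar v (b - q) (b - q')
  by apply: gen_vertex; rewrite !inE eqxx orbT.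
have gc : noncoplanar v (c - q) (c - q')
  by apply: gen_vertex; rewrite !inE eqxx !orbT.
move: f5n w0 e1 e2 => + + + + fi fj.
elim/ord6_ind: i fi => fi; elim/ord6_ind: j fj => fj //;
  rewrite ?fi ?fj ?(scale0r, addr0, add0r) => f5n w0 e1 e2; exfalso;
  first [ by rewrite eqxx in f5n | by rewrite e1 ltxx in w0
        | exact: (edge_over_point f5n gab e1 e2)
        | exact: (edge_over_point f5n gbc e1 e2)
        | exact: (edge_over_point f5n gac e1 e2)
        | exact: (edge_over_point f5n gab' e1 e2)
        | exact: (edge_over_point f5n gbc' e1 e2)
        | exact: (edge_over_point f5n gac' e1 e2)
        | exact: (point_over_edge f5n ga e1 e2)
        | exact: (point_over_edge f5n gb e1 e2)
        | exact: (point_over_edge f5n gc e1 e2) ].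
Qed.

(** The five facets are the crossings of the three sides and the hits above the two ends, and
    [balanced] makes their signs cancel. The right side is a difference, which telescopes around a
    closed polygon. *)
Lemma triangle_crossing :
  regular_pair v (a, b) (q, q') -> regular_pair v (b, c) (q, q') ->
  regular_pair v (a, c) (q, q') ->
  crossing_sign v (a, b) (q, q') + crossing_sign v (b, c) (q, q')
  - crossing_sign v (a, c) (q, q') = triangle_hit q' - triangle_hit q.
Proof.
move=> rab rbc rac.
have mab : disjoint_edges (a, b) (q, q').
  move=> s t /andP[s0 s1] t01 /= e.
  apply: (@miss (1 - s) s 0 t) => //; first by rewrite subr_ge0.
    by rewrite addr0 subrK.
  by rewrite -e scale0r addr0.
have mbc : disjoint_edges (b, c) (q, q').
  move=> s t /andP[s0 s1] t01 /= e.
  apply: (@miss 0 (1 - s) s t) => //; first by rewrite subr_ge0.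
    by rewrite add0r subrK.
  by rewrite -e scale0r add0r.
have mac : disjoint_edges (a, c) (q, q').
  move=> s t /andP[s0 s1] t01 /= e.
  apply: (@miss (1 - s) 0 s t) => //; first by rewrite subr_ge0.
    by rewrite addr0 subrK.
  by rewrite -e scale0r addr0.
(* [psi] consists of the coefficients in Cramer's rule for the vectors
   [b - a], [c - a], [q' - q] and [v]. *)
pose p1 := det3 (c - a) (q' - q) v; pose p2 := - det3 (b - a) (q' - q) v.
pose p3 := det3 (b - a) (c - a) v.
pose psi := six (- p1 - p2) p1 p2 p3 (- p3) (det3 (b - a) (c - a) (q' - q)).
have : \sum_i (if `[< facet (dependence k u) x i >] then sgz (psi i) else 0) = 0.
  apply: balanced; first by move=> *; exact: dependence_lin.
- move=> f /depE[e1 e2] f0 /[!wE] w0.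
  have [z0 z1 z2 z3 z4] : [/\ f o0 = 0, f o1 = 0, f o2 = 0, f o3 = 0 & f o4 = 0].
    by move: (f0 o0) (f0 o1) (f0 o2) (f0 o3) (f0 o4) => *; split; lra.
  elim/ord6_ind => //; move: e2; rewrite z0 z1 z2 z3 z4 !scale0r !addr0 add0r.
  by move=> /esym/eqP; rewrite scaler_eq0 (negPf v0) orbF => /eqP.
- exact: one_zero.
- apply/depE; split; first by rewrite /psi /six /=; lra.
  have := cramer (b - a) (c - a) (q' - q) v.
  rewrite -/p1 -/p3 -[det3 (b - a) (q' - q) v]opprK -/p2 /psi /six /=.
  move=> /rowP cr; apply/rowP => i; move: (cr i); rewrite !mxE; lra.
- by rewrite wE /psi /six /=; lra.
rewrite sum6 (asbool_equiv_eq facet0) (asbool_equiv_eq facet1).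
rewrite (asbool_equiv_eq facet2) (asbool_equiv_eq facet3).
rewrite (asbool_equiv_eq facet4) (@asboolF (facet _ _ o5)); last first.
  by move=> [f /feas_gt0 + f5]; rewrite f5 ltxx.
rewrite /psi /six /= !crossing_signE//= /triangle_hit -/p3.
have -> : det3 (c - b) (q' - q) v = p1 + p2.
  by rewrite /p1 /p2 !det3E !mxE; ring.
have -> : det3 (b - a) (q' - q) v = - p2 by rewrite opprK.
rewrite -/p1 -opprD !sgzN addr0.
move: (sgz (p1 + p2)) (sgz p1) (sgz p3) (sgz (det3 _ _ _)) => s1 s2 s3 s4.
by do 5!case: asboolP => _; lia.
Qed.

End TriangleMove.

(** * Change of crossings with the direction *)

Section DirectionMove.
Variables (R : realType) (v v' a b q q' : 'rV[R]_3).
Local Notation V := 'rV[R]_3.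

(** The two sector conditions record that, for some direction between [v] and [v'], an end of one
    edge lies over or under the other edge. *)
Definition sector_above_edge (z : V) := exists y0 y1 h h' : R,
  [/\ [/\ 0 <= y0, 0 <= y1, 0 <= h & 0 <= h'], 0 < y0 + y1 &
    (y0 + y1) *: z = y0 *: q + y1 *: q' + h *: v + h' *: v'].

Definition sector_below_edge (z : V) := exists x0 x1 h h' : R,
  [/\ [/\ 0 <= x0, 0 <= x1, 0 <= h & 0 <= h'], 0 < x0 + x1 &
    x0 *: a + x1 *: b = (x0 + x1) *: z + h *: v + h' *: v'].

Definition upper_sector_hit (z : V) : int :=
  if `[< sector_above_edge z >] then sgz (det3 (q' - q) v v') else 0.

Definition lower_sector_hit (z : V) : int :=
  if `[< sector_below_edge z >] then sgz (det3 (b - a) v v') else 0.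

Let k : 'I_6 -> R := six 1 1 (-1) (-1) 0 0.
Let u : 'I_6 -> V := six a b (- q) (- q') (- v) (- v').
Let x : 'I_6 -> R := six 1 1 0 0 0 0.

Let depE f : dependence k u f <-> f o0 + f o1 = f o2 + f o3 /\
  f o0 *: a + f o1 *: b = f o2 *: q + f o3 *: q' + f o4 *: v + f o5 *: v'.
Proof.
rewrite /dependence !sum6 /k /u /six /= !scalerN.
split=> -[e1 /eqP e2]; (split; first lra); apply/eqP; move: e2.
  by rewrite -!addrA -!opprD !addrA subr_eq0 ?addrA => /eqP ->.
by rewrite -!addrA -!opprD !addrA subr_eq0 ?addrA => /eqP ->.
Qed.

Let wE f : \sum_i x i * f i = f o0 + f o1.
Proof. by rewrite sum6 /x /six /= !mul1r !mul0r !addr0. Qed.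

Let feasE f : feasible (dependence k u) x f <->
  [/\ [/\ 0 <= f o0, 0 <= f o1, 0 <= f o2, 0 <= f o3 & 0 <= f o4] /\ 0 <= f o5,
   0 < f o0 + f o1, f o0 + f o1 = f o2 + f o3 &
   f o0 *: a + f o1 *: b = f o2 *: q + f o3 *: q' + f o4 *: v + f o5 *: v'].
Proof.
split=> [[/depE[e1 e2] f0]|]; first by rewrite wE.
move=> [[[p0 p1 p2 p3 p4] p5] w0 e1 e2]; split; first exact/depE.
  by elim/ord6_ind.
by rewrite wE.
Qed.

Let facet0 : facet (dependence k u) x o0 <-> sector_above_edge b.
Proof.
split=> [[f /feasE[[[p0 p1 p2 p3 p4] p5]]]|].
  move=> + + + f0; rewrite f0 scale0r !add0r => w0 e1 e2.
  exists (f o2), (f o3), (f o4), (f o5); split=> //; first by rewrite -e1.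
  by rewrite -e1.
move=> [y0 [y1 [h [h' [[? ? ? ?] m0 eq]]]]].
exists (six 0 (y0 + y1) y0 y1 h h') => //; apply/feasE.
by rewrite scale0r !add0r; split => //; split => //; split => //; exact: ltW.
Qed.

Let facet1 : facet (dependence k u) x o1 <-> sector_above_edge a.
Proof.
split=> [[f /feasE[[[p0 p1 p2 p3 p4] p5]]]|].
  move=> + + + f0; rewrite f0 scale0r !addr0 => w0 e1 e2.
  exists (f o2), (f o3), (f o4), (f o5); split=> //; first by rewrite -e1.
  by rewrite -e1.
move=> [y0 [y1 [h [h' [[? ? ? ?] m0 eq]]]]].
exists (six (y0 + y1) 0 y0 y1 h h') => //; apply/feasE.
by rewrite scale0r !addr0; split => //; split => //; split => //; exact: ltW.
Qed.

Let facet2 : facet (dependence k u) x o2 <-> sector_below_edge q'.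
Proof.
split=> [[f /feasE[[[p0 p1 p2 p3 p4] p5]]]|].
  move=> + + + f0; rewrite f0 scale0r !add0r => w0 e1 e2.
  by exists (f o0), (f o1), (f o4), (f o5); rewrite -e1 in e2.
move=> [y0 [y1 [h [h' [[? ? ? ?] m0 eq]]]]].
exists (six y0 y1 0 (y0 + y1) h h') => //; apply/feasE.
by rewrite scale0r !add0r; split => //; split => //; split => //; exact: ltW.
Qed.

Let facet3 : facet (dependence k u) x o3 <-> sector_below_edge q.
Proof.
split=> [[f /feasE[[[p0 p1 p2 p3 p4] p5]]]|].
  move=> + + + f0; rewrite f0 scale0r !addr0 => w0 e1 e2.
  by exists (f o0), (f o1), (f o4), (f o5); rewrite -e1 in e2.
move=> [y0 [y1 [h [h' [[? ? ? ?] m0 eq]]]]].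
exists (six y0 y1 (y0 + y1) 0 h h') => //; apply/feasE.
by rewrite scale0r !addr0; split => //; split => //; split => //; exact: ltW.
Qed.

Let facet4 : facet (dependence k u) x o4 <-> crosses v' (a, b) (q, q').
Proof.
split=> [[f /feasE[[[p0 p1 p2 p3 p4] p5]]]|].
  move=> + + + f0; rewrite f0 scale0r !addr0 => w0 e1 e2.
  by exists (f o0), (f o1), (f o2), (f o3), (f o5).
move=> [a0 [a1 [b0 [b1 [h [[? ? ? ? ?] m0 ab eq]]]]]].
by exists (six a0 a1 b0 b1 0 h) => //; apply/feasE; rewrite scale0r !addr0.
Qed.

Let facet5 : facet (dependence k u) x o5 <-> crosses v (a, b) (q, q').
Proof.
split=> [[f /feasE[[[p0 p1 p2 p3 p4] p5]]]|].
  move=> + + + f0; rewrite f0 scale0r !addr0 => w0 e1 e2.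
  by exists (f o0), (f o1), (f o2), (f o3), (f o4).
move=> [a0 [a1 [b0 [b1 [h [[? ? ? ? ?] m0 ab eq]]]]]].
by exists (six a0 a1 b0 b1 h 0) => //; apply/feasE; rewrite scale0r !addr0.
Qed.

Hypothesis v0 : v != 0.
Hypothesis dis : disjoint_edges (a, b) (q, q').
Hypothesis reg : regular_pair v (a, b) (q, q').
Hypothesis reg' : regular_pair v' (a, b) (q, q').
Hypothesis gen : forall p z, p \in [:: a; b] -> z \in [:: q; q'] ->
  noncoplanar v' v (p - z).

Let point_over_point p z (h h' r s : R) : noncoplanar v' v (p - z) -> h' != 0 ->
  r = s -> r *: p = s *: z + h *: v + h' *: v' -> False.
Proof.
move=> g h0 -> e2; apply: (noncoplanarP (a := - h) (b := s) g h0).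
apply/rowP => i; move/rowP/(_ i): e2; rewrite !mxE; lra.
Qed.

(** If a direction has coefficient 0, the relation is a crossing along the other one and regularity
    makes the rest positive. Otherwise two zeros leave one point over one point, whose difference
    would lie in the sector, or no mass. *)
Let one_zero f i j : feasible (dependence k u) x f -> f i = 0 -> f j = 0 -> i = j.
Proof.
move=> /feasE[[[p0 p1 p2 p3 p4] p5] w0 e1 e2].
have B4 : f o4 = 0 ->
    [/\ f o0 != 0, f o1 != 0, f o2 != 0, f o3 != 0 & f o5 != 0].
  move=> f4; move: e2; rewrite f4 scale0r addr0 => e2.
  have [] := crosses_boundary dis reg' p0 p1 p2 p3 p5 w0 e1 e2.
  by move=> *; split; rewrite gt_eqF.
have B5 : f o5 = 0 ->
    [/\ f o0 != 0, f o1 != 0, f o2 != 0, f o3 != 0 & f o4 != 0].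
  move=> f5; move: e2; rewrite f5 scale0r addr0 => e2.
  have [] := crosses_boundary dis reg p0 p1 p2 p3 p4 w0 e1 e2.
  by move=> *; split; rewrite gt_eqF.
have [f4|f4] := eqVneq (f o4) 0.
  have [n0 n1 n2 n3 n5] := B4 f4.
  elim/ord6_ind: i => /eqP fi; elim/ord6_ind: j => /eqP fj //; exfalso;
  by move: n0 n1 n2 n3 n5; rewrite ?fi ?fj.
have [f5|f5] := eqVneq (f o5) 0.
  have [n0 n1 n2 n3 n5] := B5 f5.
  elim/ord6_ind: i => /eqP fi; elim/ord6_ind: j => /eqP fj //; exfalso;
  by move: n0 n1 n2 n3 n5; rewrite ?fi ?fj.
have gaq : noncoplanar v' v (a - q) by apply: gen; rewrite !inE eqxx ?orbT.
have gbq : noncoplanar v' v (b - q) by apply: gen; rewrite !inE eqxx ?orbT.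
have gaq' : noncoplanar v' v (a - q') by apply: gen; rewrite !inE eqxx ?orbT.
have gbq' : noncoplanar v' v (b - q') by apply: gen; rewrite !inE eqxx ?orbT.
clear B4 B5; move: f4 f5 w0 e1 e2 => + + + + + fi fj.
elim/ord6_ind: i fi => fi; elim/ord6_ind: j fj => fj //;
  rewrite ?fi ?fj ?(scale0r, addr0, add0r) => f4 f5 w0 e1 e2; exfalso;
  first [ by rewrite eqxx in f4 | by rewrite eqxx in f5
        | by rewrite ltxx in w0 | by rewrite e1 ltxx in w0
        | exact: (point_over_point gaq f5 e1 e2)
        | exact: (point_over_point gbq f5 e1 e2)
        | exact: (point_over_point gaq' f5 e1 e2)
        | exact: (point_over_point gbq' f5 e1 e2) ].
Qed.

(** The facets are the two crossings and the four ends of the edges. Each sector term is a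
    difference along one edge with the other edge fixed, so it telescopes too. *)
Lemma direction_crossing :
  crossing_sign v (a, b) (q, q') - crossing_sign v' (a, b) (q, q') =
  (upper_sector_hit b - upper_sector_hit a)
  + (lower_sector_hit q' - lower_sector_hit q).
Proof.
(* As for the triangle, [psi] comes from Cramer's rule, now for [b - a], [q' - q], [v] and [v']. *)
pose p1 := det3 (q' - q) v v'; pose p3 := det3 (b - a) v v'.
pose p4 := det3 (b - a) (q' - q) v'; pose p5 := det3 (b - a) (q' - q) v.
pose psi := six (- p1) p1 (- p3) p3 (- p4) p5.
have : \sum_i (if `[< facet (dependence k u) x i >] then sgz (psi i) else 0) = 0.
  apply: balanced; first by move=> *; exact: dependence_lin.
- move=> f /depE[e1 e2] f0 /[!wE] w0.
  have [z0 z1 z2 z3] : [/\ f o0 = 0, f o1 = 0, f o2 = 0 & f o3 = 0].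
    by move: (f0 o0) (f0 o1) (f0 o2) (f0 o3) => *; split; lra.
  move: e2; rewrite z0 z1 z2 z3 !scale0r !addr0 add0r => e2.
  have f5 : f o5 = 0.
    apply/eqP/negPn/negP => f5.
    have g : noncoplanar v' v (a - q) by apply: gen; rewrite !inE eqxx ?orbT.
    apply: (noncoplanarP (a := - f o4) (b := 0) g f5).
    by rewrite scale0r addr0 scaleNr; apply/eqP; rewrite -addr_eq0 addrC -e2.
  elim/ord6_ind => //; move: e2; rewrite f5 scale0r addr0.
  by move=> /esym/eqP; rewrite scaler_eq0 (negPf v0) orbF => /eqP.
- exact: one_zero.
- apply/depE; split; first by rewrite /psi /six /=; lra.
  have := cramer (b - a) (q' - q) v v'.
  rewrite -/p1 -/p3 -/p4 -/p5 /psi /six /=.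
  move=> /rowP cr; apply/rowP => i; move: (cr i); rewrite !mxE; lra.
- by rewrite wE /psi /six /=; lra.
rewrite sum6 (asbool_equiv_eq facet0) (asbool_equiv_eq facet1).
rewrite (asbool_equiv_eq facet2) (asbool_equiv_eq facet3).
rewrite (asbool_equiv_eq facet4) (asbool_equiv_eq facet5).
rewrite /psi /six /= !crossing_signE//= /upper_sector_hit /lower_sector_hit.
rewrite -/p1 -/p3 -/p4 -/p5 !sgzN.
move: (sgz p1) (sgz p3) (sgz p4) (sgz p5) => s1 s3 s4 s5.
by do 6!case: asboolP => _; lia.
Qed.

End DirectionMove.

(** * Generic directions *)

Section Generic.
Variable R : realType.
Local Notation V := 'rV[R]_3.

(** The transpose of a pair of rows has rank at most 2, so its left kernel is nonzero even when [x]
    and [y] are dependent. *)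
Lemma common_normal (x y : V) : exists n : V, n != 0 /\
  forall a b : R, (a *: x + b *: y) *m n^T = 0.
Proof.
pose A := (col_mx x y)^T.
have : kermx A != 0.
  rewrite kermx_eq0 /row_free; apply/eqP => r.
  by have := rank_leq_col A; rewrite r.
rewrite -nz_row_eq0; set n := nz_row _ => nz.
exists n; split=> //.
have : n *m A = 0 by apply/eqP; rewrite -sub_kermx nz_row_sub.
rewrite /A tr_col_mx mul_mx_row => /eqP; rewrite row_mx_eq0 => /andP[/eqP nx /eqP ny].
move=> a b; apply: trmx_inj; rewrite trmx_mul trmxK linearD !linearZ/= mulmxDr.
by rewrite -!scalemxAr nx ny !scaler0 addr0 trmx0.
Qed.

(* A plane through 0 contains at most two points of the moment curve
   [(1, t, t ^ 2)]. *)
Lemma generic_direction (S : seq V) : exists v : V,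
  v != 0 /\ forall x y, x \in S -> y \in S -> noncoplanar v x y.
Proof.
have /choice[n hn] (p : V * V) := common_normal p.1 p.2.
(* Each factor is the value of a normal along the moment curve; outside the roots of [P] the curve
   avoids all the planes. *)
pose P := \prod_(p <- [seq (x, y) | x <- S, y <- S])
  \poly_(i < 3) (n p 0 (inord i)).
have P0 : P != 0.
  rewrite prodf_seq_neq0; apply/allP => p _ /=; apply/eqP => np0.
  have [np _] := hn p; move/eqP: np; apply; apply/rowP => i.
  have /polyP/(_ i) := np0.
  by rewrite coef_poly ltn_ord inord_val coef0 mxE.
(* A nonzero [P] has fewer than [size P] roots, so one of the first [size P] natural numbers is
   none. *)
have [t Pt] : exists t, ~~ root P t.
  apply/not_existsP => h.
  have := @max_poly_roots _ P [seq i%:R | i <- iota 0 (size P)] P0.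
  rewrite size_map size_iota ltnn map_inj_uniq ?iota_uniq; last first.
    by move=> i j /eqP; rewrite eqr_nat => /eqP.
  by move=> /(_ _ isT) contra; suff: false by []; apply: contra;
    apply/allP => t _; apply/negPn/negP/h.
exists (\row_(i < 3) t ^+ i); split.
  apply/eqP => /rowP/(_ 0); rewrite !mxE expr0 => /eqP.
  by rewrite oner_eq0.
move=> x y xS yS a b e; move: Pt; rewrite /root /P horner_prod.
rewrite prodf_seq_neq0 => /allP/(_ (x, y)).
rewrite allpairs_f// => /(_ isT)/= /negP; apply.
have [_ /(_ a b)] := hn (x, y); rewrite -e => /matrixP/(_ 0 0).
rewrite !mxE horner_poly => /eqP; congr (_ == 0); apply: eq_bigr => i _.
by rewrite !mxE inord_val mulrC.
Qed.

Lemma det3_neq0 (d : V) : d != 0 -> exists w z, det3 d w z != 0.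
Proof.
move=> d0; apply/not_existsP => h.
have {}h w z : det3 d w z = 0.
  by apply/eqP/negPn/negP => wz; apply: (h w); exists z.
pose e i : V := delta_mx 0 i.
move/eqP: d0; apply; apply/rowP; elim/ord3_ind; rewrite mxE.
- by have := h (e (@Ordinal 3 1 isT)) (e (@Ordinal 3 2 isT));
    rewrite det3E !mxE /= => <-; ring.
- by have := h (e (@Ordinal 3 2 isT)) (e (@Ordinal 3 0 isT));
    rewrite det3E !mxE /= => <-; ring.
- by have := h (e (@Ordinal 3 0 isT)) (e (@Ordinal 3 1 isT));
    rewrite det3E !mxE /= => <-; ring.
Qed.

Lemma noncoplanar_det3 (v x y : V) : x != 0 -> noncoplanar v x y ->
  exists w, det3 x v w != 0.
Proof.
move=> x0 g; apply/not_existsP => h.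
have {}h w : det3 x v w = 0 by apply/eqP/negPn/negP/h.
have [w [z wz]] := det3_neq0 x0.
have := cramer x v w z; rewrite !h !scale0r addr0 subr0 => /eqP.
rewrite subr_eq0 => /eqP e.
by apply: (noncoplanarP (a := det3 v w z) (b := 0) g wz); rewrite scale0r addr0 e.
Qed.

(** A meeting at an end of an edge would put [v] in the span of two listed differences. A meeting
    that is not transverse would make the edges parallel, and again confine [v] to such a span. *)
Lemma noncoplanar_regular (v : V) (e e' : V * V) : disjoint_edges e e' ->
  (forall x y,
     x \in [:: e.1 - e'.1; e.1 - e'.2; e.2 - e'.1; e.2 - e'.2;
               e.2 - e.1; e'.2 - e'.1] ->
     y \in [:: e.1 - e'.1; e.1 - e'.2; e.2 - e'.1; e.2 - e'.2;
               e.2 - e.1; e'.2 - e'.1] -> noncoplanar v x y) ->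
  regular_pair v e e'.
Proof.
move: e e' => [a b] [q q'] /= dis gen s t h /andP[s0 s1] /andP[t0 t1] eq.
have h0 : h != 0.
  apply/eqP => h0; apply: (dis s t); rewrite ?s0 ?t0//.
  by rewrite eq h0 scale0r addr0.
have G x y r r' : h *: v = r *: x + r' *: y -> 
    x \in [:: a - q; a - q'; b - q; b - q'; b - a; q' - q] ->
    y \in [:: a - q; a - q'; b - q; b - q'; b - a; q' - q] -> False.
  by move=> e xS yS; exact: (noncoplanarP (gen x y xS yS) h0 e).
move: eq; rewrite /segment /= => eq.
have s00 : s != 0.
  apply/eqP => sE; apply: (G (a - q) (a - q') (1 - t) t);
    rewrite ?inE ?eqxx ?orbT//.
  apply/rowP => i; move/rowP/(_ i): eq; rewrite sE !mxE; lra.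
have s11 : s != 1.
  apply/eqP => sE; apply: (G (b - q) (b - q') (1 - t) t);
    rewrite ?inE ?eqxx ?orbT//.
  apply/rowP => i; move/rowP/(_ i): eq; rewrite sE !mxE; lra.
have t00 : t != 0.
  apply/eqP => tE; apply: (G (a - q) (b - q) (1 - s) s);
    rewrite ?inE ?eqxx ?orbT//.
  apply/rowP => i; move/rowP/(_ i): eq; rewrite tE !mxE; lra.
have t11 : t != 1.
  apply/eqP => tE; apply: (G (a - q') (b - q') (1 - s) s);
    rewrite ?inE ?eqxx ?orbT//.
  apply/rowP => i; move/rowP/(_ i): eq; rewrite tE !mxE; lra.
split; [by rewrite !lt_neqAle s0 s1 !andbT eq_sym s00
      | by rewrite !lt_neqAle t0 t1 !andbT eq_sym t00 |].
apply/eqP => det0; set d := b - a in det0 G; set k := q' - q in det0 G.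
have eqv : h *: v = (a - q) + s *: d - t *: k.
  apply/rowP => i; move/rowP/(_ i): eq; rewrite !mxE; lra.
have [d0|d0] := eqVneq d 0.
  apply: (G (a - q) k 1 (- t)); rewrite ?inE ?eqxx ?orbT//.
  by rewrite eqv d0 scaler0 addr0 scale1r scaleNr.
have gdk : noncoplanar v d k.
  by apply: gen; rewrite ?inE ?eqxx ?orbT.
have [w dw] := noncoplanar_det3 d0 gdk.
(* The span of [d] and [k] misses [v], so a zero determinant with [v] forces [k] to be a multiple of
   [d]. *)
have detw : det3 d k w = 0.
  apply/eqP/negPn/negP => dkw.
  apply: (noncoplanarP (a := - det3 k v w) (b := det3 d v w) gdk dkw).
  have := cramer d k v w; rewrite det0 scale0r subr0 => /rowP cr.
  apply/rowP => i; move: (cr i); rewrite !mxE; lra.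
have := cramer d k v w; rewrite det0 detw !scale0r subr0 addr0 => /eqP.
rewrite subr_eq0 => /eqP dk.
have gad : noncoplanar v (a - q) d.
  by apply: gen; rewrite ?inE ?eqxx ?orbT.
have D0 : det3 d v w * h != 0 by rewrite mulf_neq0.
apply: (noncoplanarP (a := det3 d v w)
  (b := det3 d v w * s - t * det3 k v w) gad D0).
rewrite -scalerA eqv; move/rowP: dk => dk; apply/rowP => i; move: (dk i).
move: (det3 d v w) (det3 k v w) => D D'.
move: d k {G det0 eqv d0 gdk dw detw dk gad D0} => d k; rewrite !mxE => dki.
have -> : D * (a 0 i - q 0 i + s * d 0 i - t * k 0 i) =
  D * (a 0 i - q 0 i) + D * s * d 0 i - t * (D * k 0 i) by ring.
rewrite -dki; ring.
Qed.

End Generic.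

(** * Invariance of the crossing number *)

Section Pairmap.
Variables (R : realType).

Lemma big_pairmap (T U : Type) (W : nmodType) (f : T -> T -> U) (F : U -> W) a s :
  \sum_(e <- pairmap f a s) F e = \sum_(j <- pairmap (fun x y => F (f x y)) a s) j.
Proof. by elim: s a => [|x s IH] a /=; rewrite ?big_nil// !big_cons IH. Qed.

Lemma telescope_pairmap (T : Type) (phi : T -> int) a s :
  \sum_(j <- pairmap (fun x y => phi y - phi x) a s) j = phi (last a s) - phi a.
Proof.
elim: s a => [|x s IH] a /=; first by rewrite big_nil subrr.
by rewrite big_cons IH addrC addrA subrK.
Qed.

Lemma path_last_le (a : R) s : path <%R a s -> all (fun x => x <= last a s) (a :: s).
Proof.
elim: s a => [|x s IH] a /=; first by rewrite lexx.
move=> /andP[ax /IH/= /andP[xl sl]].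
by rewrite xl sl (ltW (lt_le_trans ax xl)).
Qed.

(* Both partitions are run through simultaneously, always advancing the one
   whose next point is smaller. *)
Lemma pairmap_cocycle (J : R -> R -> int) (X : seq R) (eta c a b : R) s s' :
  (forall x y z, x \in X -> y \in X -> z \in X ->
    `|x - y| < eta -> `|y - z| < eta -> `|x - z| < eta -> J x y + J y z = J x z) ->
  {subset a :: s <= X} -> {subset b :: s' <= X} ->
  path <%R a s -> path <%R b s' -> last a s = c -> last b s' = c ->
  path (fun x y => y - x < eta) a s -> path (fun x y => y - x < eta) b s' ->
  0 < eta -> `|a - b| < eta ->
  all (>= b) s -> all (>= a) s' ->
  J b a + \sum_(j <- pairmap J a s) j = \sum_(j <- pairmap J b s') j.
Proof.
move=> HJ sX s'X ps ps' ls ls' fs fs' eta0.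
have [n] := ubnP (size s + size s').
elim: n => // n IH in s s' a b sX s'X ps ps' ls ls' fs fs' *.
have XA : a \in X by apply: sX; rewrite mem_head.
have XB : b \in X by apply: s'X; rewrite mem_head.
have d0 x : `|x - x| < eta by rewrite subrr normr0.
have J0 x : x \in X -> J x x = 0.
  by move=> xX; apply: (addrI (J x x)); rewrite HJ// addr0.
case: s s' sX s'X ps ps' ls ls' fs fs' => [|x s] [|y s'] sX s'X /=.
- by move=> _ _ ac bc *; rewrite !big_nil addr0 bc -ac J0.
- move=> _ /andP[by_ p'] ac l' _ _ _ ab _ /andP[ay _].
  have := path_last_le p'; rewrite l' -ac /= => /andP[ya].
  have ey : y = a by apply/eqP; rewrite eq_le ya ay.
  case: s' {s'X} p' l' => [|z s'] /= p' l'.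
    by move=> _; rewrite !big_cons !big_nil ey.
  move=> /andP[za]; move: p' => /andP[yz _].
  by move: (lt_le_trans yz za); rewrite ey ltxx.
- move=> /andP[ax p] _ l bc _ _ _ ab /andP[bx _] _.
  have := path_last_le p; rewrite l -bc /= => /andP[xb].
  have ex : x = b by apply/eqP; rewrite eq_le xb bx.
  case: s {sX} p l => [|z s] /= p l.
    move=> _; rewrite !big_cons !big_nil ex addr0 HJ ?J0// 1?distrC//.
  move=> /andP[zb]; move: p => /andP[xz _].
  by move: (lt_le_trans xz zb); rewrite ex ltxx.
move=> /andP[ax p] /andP[by_ p'] l l' /andP[fx f] /andP[fy f'] sz ab.
move=> /andP[bx bs] /andP[ay as'].
have xX : x \in X by apply: sX; rewrite !inE eqxx orbT.
have yX : y \in X by apply: s'X; rewrite !inE eqxx orbT.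
have [xy|yx] := leP x y.
  have bxe : `|b - x| < eta by rewrite ler0_norm; lra.
  have axe : `|a - x| < eta by rewrite ler0_norm; lra.
  rewrite big_cons addrA HJ//; last by rewrite distrC.
  apply: (IH s (y :: s')) => //=.
  - by move=> z zs; apply: sX; rewrite inE zs orbT.
  - by rewrite by_.
  - by rewrite fy.
  - by rewrite distrC.
  rewrite xy; apply/allP => z zs'; rewrite (le_trans xy)// ltW//.
  by move/(order_path_min lt_trans)/allP: p'; apply.
have bye : `|b - y| < eta by rewrite ler0_norm; lra.
have aye : `|a - y| < eta by rewrite ler0_norm; lra.
rewrite [RHS]big_cons -(IH (x :: s) s' a y) //=.
- by rewrite addrA HJ// 1?distrC.
- by move=> z zs; apply: s'X; rewrite inE zs orbT.
- by rewrite ax.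
- by rewrite fx.
- by move: sz; rewrite addSn addnS ltnS.
rewrite (ltW yx); apply/allP => z zs; rewrite (le_trans (ltW yx))// ltW//.
by move/(order_path_min lt_trans)/allP: p; apply.
Qed.

End Pairmap.

(** * Symmetries of crossing signs *)

Section Polygons.
Variable R : realType.
Local Notation V := 'rV[R]_3.
Implicit Types (g d : R -> V) (v : V) (s t : seq R) (A : seq V).

Lemma det3_swap (a b v : V) : det3 a b v = det3 b a (- v).
Proof. by rewrite !det3E !mxE; ring. Qed.

(** Seen from the opposite side, the upper and lower strands change roles while the determinant
    keeps its value. *)
Lemma crossing_sign_swap v (e e' : V * V) :
  crossing_sign v e e' = crossing_sign (- v) e' e.
Proof.
rewrite /crossing_sign -det3_swap; congr (if _ then _ else _).
apply/asbool_equiv_eq; split=> -[x [y [h [? ? ? e0]]]]; exists y, x, h.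
  by split=> //; rewrite e0 scalerN addrK.
by split=> //; rewrite e0 scalerN subrK.
Qed.

Lemma crossing_number_swap v (P Q : seq (V * V)) :
  crossing_number v P Q = crossing_number (- v) Q P.
Proof.
rewrite /crossing_number exchange_big; apply: eq_bigr => e' _.
by apply: eq_bigr => e _; rewrite crossing_sign_swap.
Qed.

Lemma crossing_sign_rev v (a b q q' : V) :
  crossing_sign v (a, b) (q', q) = - crossing_sign v (a, b) (q, q').
Proof.
rewrite /crossing_sign /=.
have -> : det3 (b - a) (q - q') v = - det3 (b - a) (q' - q) v.
  by rewrite !det3E !mxE; ring.
rewrite sgzN.
have -> : `[< exists x y h : R, [/\ 0 < x < 1, 0 < y < 1, 0 < h &
    segment (a, b) x = segment (q', q) y + h *: v] >] =
  `[< exists x y h : R, [/\ 0 < x < 1, 0 < y < 1, 0 < h &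
    segment (a, b) x = segment (q, q') y + h *: v] >].
  apply/asbool_equiv_eq; split=> -[x [y [h [? ? ? e]]]];
    exists x, (1 - y), h; (split=> //; first by lra);
    by rewrite e /segment /= subKr [X in X + _ = _]addrC.
by case: ifP => // _; rewrite oppr0.
Qed.

End Polygons.

(** * Independence of partitions and direction *)

Section Invariance.
Variable R : realType.
Local Notation V := 'rV[R]_3.
Implicit Types (g d : R -> V) (v : V) (s t : seq R) (A : seq V).

Definition fine_at (eta r : R) g := forall x y, 0 <= x <= 1 -> 0 <= y <= 1 ->
  `|x - y| < eta -> `|g x - g y| < r.

(** The factor 2 leaves room for a deviation of [r] on each curve. *)
Definition far (r : R) g d := forall x y, 0 <= x <= 1 -> 0 <= y <= 1 ->
  2 * r < `|g x - d y|.

Lemma far_sym r g d : far r g d -> far r d g.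
Proof. by move=> f x y x01 y01; rewrite distrC; exact: f. Qed.

(** A common point would be within [r] of both [g x] and [d q], which are more than [2 * r]
    apart. *)
Lemma fine_triangle_misses (eta r : R) g d (x y z q q' : R) :
  fine_at eta r g -> fine_at eta r d -> far r g d ->
  0 <= x <= 1 -> 0 <= y <= 1 -> 0 <= z <= 1 -> 0 <= q <= 1 -> 0 <= q' <= 1 ->
  `|x - y| < eta -> `|x - z| < eta -> `|q - q'| < eta ->
  triangle_misses (g x) (g y) (g z) (d q, d q').
Proof.
move=> fg fd fr x01 y01 z01 q01 q'01 xy xz qq x0 x1 x2 t x00 x10 x20 x1E.
move=> /andP[t0 t1] e.
have := fr _ _ x01 q01; rewrite ltNge => /negP; apply.
have -> : g x - d q = x1 *: (g x - g y) + x2 *: (g x - g z) - t *: (d q - d q').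
  have x0E : x0 = 1 - x1 - x2 by lra.
  move: e; rewrite x0E /segment /= => /rowP e; apply/rowP => i; move: (e i).
  rewrite !mxE; lra.
rewrite (le_trans (ler_normB _ _))// (le_trans (lerD (ler_normD _ _) (lexx _)))//.
rewrite !normrZ !ger0_norm//.
have lxy := ltW (fg _ _ x01 y01 xy); have lxz := ltW (fg _ _ x01 z01 xz).
have lqq := ltW (fd _ _ q01 q'01 qq).
have r0 : 0 <= r by exact: le_trans lxy.
have h1 := ler_wpM2l x10 lxy; have h2 := ler_wpM2l x20 lxz.
have h3 := ler_wpM2l t0 lqq.
have h4 : x1 * r + x2 * r <= r by rewrite -mulrDl ler_piMl//; lra.
have h5 : t * r <= r by rewrite ler_piMl.
lra.
Qed.

Lemma fine_disjoint_edges (eta r : R) g d (x y q q' : R) :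
  fine_at eta r g -> fine_at eta r d -> far r g d ->
  0 <= x <= 1 -> 0 <= y <= 1 -> 0 <= q <= 1 -> 0 <= q' <= 1 ->
  `|x - y| < eta -> `|q - q'| < eta ->
  disjoint_edges (g x, g y) (d q, d q').
Proof.
move=> fg fd fr x01 y01 q01 q'01 xy qq s t /andP[s0 s1] t01 e.
(* The edge is treated as a degenerate triangle. *)
apply: (fine_triangle_misses fg fd fr x01 y01 y01 q01 q'01 xy xy qq
  (x0 := 1 - s) (x1 := s) (x2 := 0) (t := t)) => //; first by rewrite subr_ge0.
  by rewrite addr0 subrK.
by rewrite -e scale0r addr0.
Qed.

Definition differences A := [seq p - q | p <- A, q <- A].

Definition generic v A := v != 0 /\ forall x y,
  x \in differences A -> y \in differences A -> noncoplanar v x y.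

Lemma mem_differences A p q : p \in A -> q \in A -> p - q \in differences A.
Proof. by move=> pA qA; apply/allpairsP; exists (p, q). Qed.

Lemma generic_opp v A : generic v A -> generic (- v) A.
Proof.
move=> [v0 gen]; split; first by rewrite oppr_eq0.
move=> x y xA yA a b e; apply: (gen x y xA yA (- a) (- b)).
by rewrite !scaleNr -opprD -e opprK.
Qed.

Lemma generic_regular v A e e' : generic v A -> disjoint_edges e e' ->
  e.1 \in A -> e.2 \in A -> e'.1 \in A -> e'.2 \in A -> regular_pair v e e'.
Proof.
move=> [v0 gen] dis e1 e2 e'1 e'2; apply: noncoplanar_regular => // x y xS yS.
by apply: gen; [move: x xS|move: y yS]; apply/allP; rewrite /= !mem_differences.
Qed.

Definition short (eta : R) (xy : R * R) :=
  [&& 0 <= xy.1 <= 1, 0 <= xy.2 <= 1 & `|xy.1 - xy.2| < eta].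

Lemma fine_partition_short eta s : fine_partition eta s ->
  all (short eta) (pairmap pair 0 s) /\ all (fun x => 0 <= x <= 1) (0 :: s).
Proof.
move=> [[p /eqP l] f].
have : all (fun x => 0 <= x <= 1) (0 :: s).
  apply/allP => x xs; apply/andP; split; last first.
    by have := allP (path_last_le p) x xs; rewrite l.
  move: xs; rewrite inE => /orP[/eqP->//|xs].
  exact: ltW (allP (order_path_min lt_trans p) x xs).
move=> h; split => //.
suff H a : path <%R a s -> path (fun x y => y - x < eta) a s ->
    all (fun x => 0 <= x <= 1) (a :: s) -> all (short eta) (pairmap pair a s).
  exact: H.
elim: s a {l p f h} => //= x s IH a.
move=> /andP[ax p] /andP[fx f] /and3P[a01 x01 s01].
apply/andP; split; last by apply: IH => //=; rewrite x01.
by rewrite /short /= a01 x01 /= distrC ger0_norm// subr_ge0 ltW.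
Qed.

Lemma inscribedE g s :
  inscribed g s = [seq (g xy.1, g xy.2) | xy <- pairmap pair 0 s].
Proof. by rewrite /inscribed; elim: s 0 => //= x s IH a; rewrite -IH. Qed.

Lemma mem_pairmap_pair (T : eqType) (a : T) (s : seq T) xy :
  xy \in pairmap pair a s -> xy.1 \in a :: s /\ xy.2 \in a :: s.
Proof.
elim: s a => // x s IH a /=; rewrite inE => /orP[/eqP -> /=|/IH[h1 h2]].
  by rewrite !inE !eqxx orbT.
by split; rewrite in_cons; apply/orP; right.
Qed.

(** The difference is a sum of sector terms, each telescoping around one closed polygon while an
    edge of the other is fixed. *)
Lemma crossing_number_direction (eta r : R) g d s t v v' :
  fine_at eta r g -> fine_at eta r d -> far r g d -> g 0 = g 1 -> d 0 = d 1 ->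
  fine_partition eta s -> fine_partition eta t -> v != 0 ->
  regular_projection v (inscribed g s) (inscribed d t) ->
  regular_projection v' (inscribed g s) (inscribed d t) ->
  (forall x y, x \in 0 :: s -> y \in 0 :: t -> noncoplanar v' v (g x - d y)) ->
  crossing_number v (inscribed g s) (inscribed d t) =
  crossing_number v' (inscribed g s) (inscribed d t).
Proof.
move=> fg fd fr g01 d01 fs ft v0 [_ reg] [_ reg'] gen.
have [ss _] := fine_partition_short fs; have [st _] := fine_partition_short ft.
apply/eqP; rewrite -subr_eq0; apply/eqP; rewrite /crossing_number -sumrB.
pose U (e' : V * V) z := upper_sector_hit v v' e'.1 e'.2 z.
pose L (e : V * V) z := lower_sector_hit v v' e.1 e.2 z.
transitivity (\sum_(e <- inscribed g s) \sum_(e' <- inscribed d t)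
  ((U e' e.2 - U e' e.1) + (L e e'.2 - L e e'.1))).
  rewrite big_seq [RHS]big_seq; apply: eq_bigr => e eP.
  rewrite -sumrB big_seq [RHS]big_seq; apply: eq_bigr => e' eQ.
  have := reg _ _ eP eQ; have := reg' _ _ eP eQ.
  move: eP eQ; rewrite !inscribedE => /mapP[[x y] xy ->] /mapP[[z w] zw ->] /=.
  move=> rr' rr; have /and3P[/= x01 y01 dxy] := allP ss _ xy.
  have /and3P[/= z01 w01 dzw] := allP st _ zw.
  have [xs ys] := mem_pairmap_pair xy; have [zt wt] := mem_pairmap_pair zw.
  apply: direction_crossing => //.
    exact: (fine_disjoint_edges fg fd fr x01 y01 z01 w01).
  by move=> p q; rewrite !inE => /orP[] /eqP -> /orP[] /eqP ->; exact: gen.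
have closed (c : R -> V) u (phi : V -> int) : c 0 = c 1 -> fine_partition eta u ->
    \sum_(e <- inscribed c u) (phi e.2 - phi e.1) = 0.
  move=> c01 [[_ /eqP l] _]; rewrite big_pairmap /=.
  by rewrite (telescope_pairmap (phi \o c)) /= l c01 subrr.
under eq_bigr do rewrite big_split /= (closed d t)// addr0.
by rewrite exchange_big big1// => e' _; exact: closed.
Qed.

Lemma generic_regular_projection (eta r : R) g d s t v A :
  fine_at eta r g -> fine_at eta r d -> far r g d ->
  fine_partition eta s -> fine_partition eta t -> generic v A ->
  {subset map g (0 :: s) <= A} -> {subset map d (0 :: t) <= A} ->
  regular_projection v (inscribed g s) (inscribed d t).
Proof.
move=> fg fd fr fs ft gen sA tA; split; first by case: gen.
have [ss _] := fine_partition_short fs; have [st _] := fine_partition_short ft.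
move=> e e'; rewrite !inscribedE => /mapP[[x y] xy ->] /mapP[[z w] zw ->].
have /and3P[/= x01 y01 dxy] := allP ss _ xy.
have /and3P[/= z01 w01 dzw] := allP st _ zw.
have [xs ys] := mem_pairmap_pair xy; have [zt wt] := mem_pairmap_pair zw.
apply: (generic_regular gen); rewrite /=.
- exact: (fine_disjoint_edges fg fd fr x01 y01 z01 w01).
- by apply: sA; exact: map_f.
- by apply: sA; exact: map_f.
- by apply: tA; exact: map_f.
- by apply: tA; exact: map_f.
Qed.

(** The crossings [J] of one edge of [g] with the whole polygon of [d] are additive on short
    triangles, since the triangle terms telescope around that closed polygon; so [pairmap_cocycle]
    applies. *)
Lemma crossing_number_partition (eta r : R) g d s s' t v A : 0 < eta ->
  fine_at eta r g -> fine_at eta r d -> far r g d -> d 0 = d 1 ->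
  fine_partition eta s -> fine_partition eta s' -> fine_partition eta t ->
  generic v A -> {subset map g (0 :: s) <= A} -> {subset map g (0 :: s') <= A} ->
  {subset map d (0 :: t) <= A} ->
  crossing_number v (inscribed g s) (inscribed d t) =
  crossing_number v (inscribed g s') (inscribed d t).
Proof.
move=> eta0 fg fd fr d01 fs fs' ft gen sA s'A tA.
have [_ s01] := fine_partition_short fs; have [_ s'01] := fine_partition_short fs'.
have [st _] := fine_partition_short ft.
pose J x y := \sum_(e' <- inscribed d t) crossing_sign v (g x, g y) e'.
have cnE u : crossing_number v (inscribed g u) (inscribed d t) =
    \sum_(j <- pairmap J 0 u) j by exact: big_pairmap.
rewrite !cnE.
pose X := (0 :: s) ++ (0 :: s').
have X01 x : x \in X -> 0 <= x <= 1.
  by rewrite mem_cat => /orP[]; [exact: (allP s01)|exact: (allP s'01)].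
have XA x : x \in X -> g x \in A.
  by rewrite mem_cat => /orP[] xs; [apply: sA|apply: s'A]; exact: map_f.
have Jadd x y z : x \in X -> y \in X -> z \in X -> `|x - y| < eta ->
    `|y - z| < eta -> `|x - z| < eta -> J x y + J y z = J x z.
  move=> xX yX zX xy yz xz; apply/eqP; rewrite -subr_eq0; apply/eqP.
  rewrite /J -big_split -sumrB /=.
  pose T e' := triangle_hit v (g x) (g y) (g z) e'.
  transitivity (\sum_(e' <- inscribed d t) (T e'.2 - T e'.1)); last first.
    case: ft => -[_ /eqP l] _; rewrite big_pairmap /=.
    by rewrite (telescope_pairmap (T \o d)) /= l d01 subrr.
  rewrite big_seq [RHS]big_seq; apply: eq_bigr => e' eQ.
  move: eQ; rewrite inscribedE => /mapP[[q q'] qq' ->] /=.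
  have /and3P[/= q01 q'01 dqq'] := allP st _ qq'.
  have [qt q't] := mem_pairmap_pair qq'.
  have dqA : d q \in A by apply: tA; exact: map_f.
  have dq'A : d q' \in A by apply: tA; exact: map_f.
  have D x' y' : x' \in X -> y' \in X -> `|x' - y'| < eta ->
      regular_pair v (g x', g y') (d q, d q').
    move=> x'X y'X xy'; apply: (generic_regular gen); rewrite /= ?XA//.
    exact: (fine_disjoint_edges fg fd fr (X01 _ x'X) (X01 _ y'X) q01 q'01).
  have [v0 gen'] := gen.
  apply: triangle_crossing => //; [|  | |exact: D|exact: D|exact: D].
  - exact: (fine_triangle_misses fg fd fr (X01 _ xX) (X01 _ yX) (X01 _ zX)).
  - move=> p; rewrite !inE => pq.
    have pA : p \in A by case/orP: pq => /eqP ->.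
    by split; apply: gen'; apply: mem_differences => //; exact: XA.
  - move=> p; rewrite !inE => pq.
    have pA : p \in A by case/or3P: pq => /eqP ->; exact: XA.
    by apply: gen'; exact: mem_differences.
have J00 : J 0 0 = 0.
  have X0 : 0 \in X by rewrite mem_cat mem_head.
  by apply: (addrI (J 0 0)); rewrite addr0 Jadd// subrr normr0.
case: fs fs' => -[ps /eqP ls] fs [[ps' /eqP ls'] fs'].
rewrite -[LHS]add0r -[X in X + _]J00; apply: (pairmap_cocycle Jadd _ _ ps ps' ls ls') => //.
- by move=> x xs; rewrite mem_cat xs.
- by move=> x xs; rewrite mem_cat xs orbT.
- by rewrite subrr normr0.
- apply/allP => x xs; have : x \in 0 :: s by rewrite inE xs orbT.
  by move=> /(allP s01)/andP[].
- apply/allP => x xs; have : x \in 0 :: s' by rewrite inE xs orbT.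
  by move=> /(allP s'01)/andP[].
Qed.

(** [W] lists given directions to which the new one will be compared by
    [crossing_number_direction]. *)
Lemma generic_exists A (W : seq V) : exists v, generic v A /\
  forall w p q, w \in W -> p \in A -> q \in A -> noncoplanar v w (p - q).
Proof.
have [v [v0 gen]] := generic_direction (W ++ differences A).
exists v; split; first split => //.
  by move=> x y xA yA; apply: gen; rewrite mem_cat ?xA ?yA orbT.
by move=> w p q wW pA qA; apply: gen; rewrite mem_cat ?wW// mem_differences ?orbT.
Qed.

(** Both projections are moved to one direction [u], generic for the vertices of all four polygons;
    there the partitions are changed one curve at a time. *)
Lemma crossing_number_invariant (eta r : R) g d s t v s' t' v' : 0 < eta ->
  fine_at eta r g -> fine_at eta r d -> far r g d -> g 0 = g 1 -> d 0 = d 1 ->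
  fine_partition eta s -> fine_partition eta t ->
  fine_partition eta s' -> fine_partition eta t' ->
  regular_projection v (inscribed g s) (inscribed d t) ->
  regular_projection v' (inscribed g s') (inscribed d t') ->
  crossing_number v (inscribed g s) (inscribed d t) =
  crossing_number v' (inscribed g s') (inscribed d t').
Proof.
move=> eta0 fg fd fr g01 d01 fs ft fs' ft' reg reg'.
pose A := map g (0 :: s) ++ map g (0 :: s') ++ map d (0 :: t) ++ map d (0 :: t').
have sA : {subset map g (0 :: s) <= A} by move=> x xs; rewrite !mem_cat xs.
have s'A : {subset map g (0 :: s') <= A}.
  by move=> x xs; rewrite !mem_cat xs !orbT.
have tA : {subset map d (0 :: t) <= A}.
  by move=> x xs; rewrite !mem_cat xs !orbT.
have t'A : {subset map d (0 :: t') <= A}.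
  by move=> x xs; rewrite !mem_cat xs !orbT.
have [u [gen genW]] := generic_exists A [:: v; v'].
have [v0 _] := reg; have [v'0 _] := reg'.
rewrite (crossing_number_direction fg fd fr g01 d01 fs ft v0 reg (v' := u));
  first last.
- move=> x y xs yt; apply: genW; first by rewrite mem_head.
    by apply: sA; exact: map_f.
  by apply: tA; exact: map_f.
- exact: (generic_regular_projection fg fd fr fs ft gen).
rewrite (crossing_number_partition eta0 fg fd fr d01 fs fs' ft gen)//.
(* Exchanging the curves reduces the second partition to the case of the first. *)
rewrite crossing_number_swap.
rewrite (crossing_number_partition eta0 fd fg (far_sym fr) g01 ft ft' fs'
  (generic_opp gen))// -crossing_number_swap.
rewrite (crossing_number_direction fg fd fr g01 d01 fs' ft' v'0 reg' (v' := u))//.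
  exact: (generic_regular_projection fg fd fr fs' ft' gen).
move=> x y xs yt; apply: genW; first by rewrite !inE eqxx orbT.
  by apply: s'A; exact: map_f.
by apply: t'A; exact: map_f.
Qed.

End Invariance.

(** * Curves and the linking number *)

Section Continuity.
Variable R : realType.
Local Notation V := 'rV[R]_3.

Lemma within_continuous_dist (U W : normedModType R) (A : set U) (f : U -> W) :
  {within A, continuous f} -> forall x, A x -> forall e : R, 0 < e ->
  exists2 delta : R, 0 < delta &
    forall y, A y -> `|x - y| < delta -> `|f x - f y| < e.
Proof.
move=> /subspace_continuousP cf x Ax e e0.
have /cvgrPdist_lt/(_ e e0) := cf x Ax.
rewrite near_withinE => /nbhs_ballP[delta /= d0 h].
exists delta => // y Ay xy; apply: h => //.
by rewrite -ball_normE.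
Qed.

Definition continuous_path (g : R -> V) := forall x, 0 <= x <= 1 ->
  forall e : R, 0 < e -> exists2 delta : R, 0 < delta &
    forall y, 0 <= y <= 1 -> `|x - y| < delta -> `|g x - g y| < e.

Lemma continuous_path_within (g : R -> V) :
  {within `[0, 1], continuous g} -> continuous_path g.
Proof.
move=> cg x x01 e e0.
have [|delta d0 h] := within_continuous_dist cg _ e0 (x := x).
  by rewrite /= in_itv.
by exists delta => // y y01; apply: h; rewrite /= in_itv.
Qed.

(** Uniform continuity, by a covering argument on the compact interval. *)
Lemma continuous_path_fine (g : R -> V) (r : R) : continuous_path g -> 0 < r ->
  exists2 eta, 0 < eta & fine_at eta r g.
Proof.
move=> cg r0; have r20 : 0 < r / 2 by rewrite divr_gt0.
pose P (eta x : R) := forall y : R, 0 <= x <= 1 -> 0 <= y <= 1 -> `|x - y| < eta ->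
  `|g x - g y| < r.
have /compact_near_coveringP cov := @segment_compact R 0 1.
have H (x : R) : `[0, 1]%classic x -> \forall x' \near x & eta \near 0^'+, P eta x'.
  rewrite /= in_itv /= => x01; have [delta d0 h] := cg x x01 _ r20.
  have d20 : 0 < delta / 2 by rewrite divr_gt0.
  near=> x' eta => y x'01 y01 xy.
  have xx' : `|x - x'| < delta / 2.
    by near: x'; apply/nbhs_ballP; exists (delta / 2).
  have ed : eta < delta / 2 by near: eta; exact: nbhs_right_lt.
  have h1 : `|g x - g x'| < r / 2 by apply: h => //; lra.
  have h2 : `|g x - g y| < r / 2.
    apply: h => //; rewrite (le_lt_trans (ler_distD x' _ _))//.
    by rewrite (splitr delta) ltrD// (lt_trans xy).
  rewrite (le_lt_trans (ler_distD (g x) _ _))// distrC.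
  by rewrite (splitr r) ltrD.
have near_eta := cov _ _ _ _ H.
have [eta [eta0 etaP]] : exists eta, 0 < eta /\ `[0, 1]%classic `<=` P eta.
  near (0 : R)^'+ => eta; exists eta; split.
    by near: eta; exact: nbhs_right_gt.
  by near: eta; exact: near_eta.
exists eta => // x y x01 y01; exact: (etaP x).
Unshelve. all: by end_near. Qed.

Lemma disjoint_paths_far (g d : R -> V) : continuous_path g -> continuous_path d ->
  (forall x y, 0 <= x <= 1 -> 0 <= y <= 1 -> g x <> d y) ->
  exists2 r, 0 < r & far r g d.
Proof.
move=> cg cd gd.
pose K := `[0, 1]%classic `*` `[0, 1]%classic : set (R * R).
pose P (r : R) (p : R * R) := 0 <= p.1 <= 1 -> 0 <= p.2 <= 1 ->
  2 * r < `|g p.1 - d p.2|.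
have cK : compact K by apply: compact_setX; exact: segment_compact.
move: cK => /compact_near_coveringP cov.
have H (p : R * R) : K p -> \forall p' \near p & r \near 0^'+, P r p'.
  move=> [] /=; rewrite !in_itv /= => p1 p2.
  (* Of the distance at [p], the two deviations use at most a quarter each; the remaining half
     exceeds [2 * r]. *)
  have e0 : 0 < `|g p.1 - d p.2| / 4.
    by rewrite divr_gt0// normr_gt0 subr_eq0; apply/eqP/gd.
  have [a a0 ha] := cg _ p1 _ e0; have [b b0 hb] := cd _ p2 _ e0.
  near=> p' r => p'1 p'2.
  have h1 : `|g p.1 - g p'.1| < `|g p.1 - d p.2| / 4.
    by apply: ha => //; near: p'; exists (ball p.1 a, setT) => /=;
      [split; [exact: nbhsx_ballx|exact: filterT]|move=> z []].
  have h2 : `|d p.2 - d p'.2| < `|g p.1 - d p.2| / 4.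
    by apply: hb => //; near: p'; exists (setT, ball p.2 b) => /=;
      [split; [exact: filterT|exact: nbhsx_ballx]|move=> z []].
  have h3 : r < `|g p.1 - d p.2| / 4 by near: r; exact: nbhs_right_lt.
  have := ler_distD (g p'.1) (g p.1) (d p.2).
  have := ler_distD (d p'.2) (g p'.1) (d p.2).
  rewrite (distrC (d p'.2)) /=; lra.
have near_r := cov _ _ _ _ H.
have [r [r0 rP]] : exists r, 0 < r /\ K `<=` P r.
  near (0 : R)^'+ => r; exists r; split.
    by near: r; exact: nbhs_right_gt.
  by near: r; exact: near_r.
exists r => // x y x01 y01; exact: (rP (x, y)).
Unshelve. all: by end_near. Qed.

End Continuity.

Lemma path_pairmap (T : Type) (e : rel T) a s :
  path e a s = all id (pairmap e a s).
Proof. by elim: s a => //= x s IH a; rewrite IH. Qed.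

Section LinkingNumber.
Variable R : realType.
Local Notation V := 'rV[R]_3.

Definition uniform_partition (N : nat) : seq R :=
  [seq i.+1%:R / N%:R | i <- iota 0 N].

Lemma pairmap_uniform (U : Type) (F : R -> R -> U) (N : nat) :
  pairmap F 0 (uniform_partition N) =
  [seq F (i%:R / N%:R) (i.+1%:R / N%:R) | i <- iota 0 N].
Proof.
suff H M k : pairmap F (k%:R / N%:R) [seq i.+1%:R / N%:R | i <- iota k M] =
    [seq F (i%:R / N%:R) (i.+1%:R / N%:R) | i <- iota k M].
  by have := H N 0%N; rewrite mul0r.
by elim: M k => //= M IH k; rewrite IH.
Qed.

Lemma uniform_partition_fine (eta : R) (N : nat) : (0 < N)%N -> N%:R^-1 < eta ->
  fine_partition eta (uniform_partition N).
Proof.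
move=> N0 Neta; have NR : 0 < N%:R :> R by rewrite ltr0n.
split; last first.
  rewrite path_pairmap pairmap_uniform; apply/allP => _ /mapP[i _ ->] /=.
  by rewrite -mulrBl -natrB// subSnn mul1r.
split.
  rewrite path_pairmap pairmap_uniform; apply/allP => _ /mapP[i _ ->] /=.
  by rewrite ltr_pM2r ?invr_gt0// ltr_nat.
case: N N0 NR {Neta} => // N _ NR; rewrite /uniform_partition.
by rewrite -addn1 iotaD map_cat last_cat /= add0n addn1 divff// gt_eqF.
Qed.

Lemma exists_uniform (eta : R) : 0 < eta -> exists N : nat,
  (0 < N)%N /\ N%:R^-1 < eta.
Proof.
move=> eta0; exists (Num.truncn eta^-1).+1; split=> //.
by rewrite invf_plt ?posrE// truncnS_gt.
Qed.

(** Invariance makes the crossing number a linking number with mesh [eta]. Any other value agrees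
    with it on a uniform partition fine enough for both meshes. *)
Lemma LkE (eta r : R) g d s t (v : V) : 0 < eta ->
  fine_at eta r g -> fine_at eta r d -> far r g d -> g 0 = g 1 -> d 0 = d 1 ->
  fine_partition eta s -> fine_partition eta t ->
  regular_projection v (inscribed g s) (inscribed d t) ->
  Lk g d = crossing_number v (inscribed g s) (inscribed d t).
Proof.
move=> eta0 fg fd fr g01 d01 fs ft reg; set k := crossing_number _ _ _.
have isk : is_linking_number g d k.
  exists eta => // s' t' v' fs' ft' reg'.
  exact: (crossing_number_invariant eta0 fg fd fr).
apply: xget_unique => //= k' [eta' eta'0 hk'].
have [eta1 [eta10 eta1l eta1l']] : exists eta1, [/\ 0 < eta1, eta1 <= eta & eta1 <= eta'].
  by exists (Num.min eta eta'); rewrite lt_min eta0 eta'0 !ge_min !lexx orbT.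
have [N [N0 Neta]] := exists_uniform eta10.
have fN : fine_partition eta (uniform_partition N).
  by apply: uniform_partition_fine => //; exact: lt_le_trans eta1l.
have fN' : fine_partition eta' (uniform_partition N).
  by apply: uniform_partition_fine => //; exact: lt_le_trans eta1l'.
pose A := map g (0 :: uniform_partition N) ++ map d (0 :: uniform_partition N).
have [u [gen _]] := generic_exists A [::].
have regu : regular_projection u (inscribed g (uniform_partition N))
    (inscribed d (uniform_partition N)).
  by apply: (generic_regular_projection fg fd fr fN fN gen) => x xA;
    rewrite mem_cat xA ?orbT.
rewrite -(hk' _ _ _ fN' fN' regu).
exact: (crossing_number_invariant eta0 fg fd fr).
Qed.

End LinkingNumber.

(** * Loops composed of consecutive paths *)

Section ConcatLoop.
Variable R : realType.
Local Notation V := 'rV[R]_3.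
Variable es : seq (R -> V).
Local Notation m := (size es).
Local Notation piece k := (nth (fun=> 0) es k).
Hypothesis joint : forall k, (k < m)%N -> piece k 1 = piece (k.+1 %% m)%N 0.

(** At [u = 1] the loop already reads the start of the next path, which [joint] identifies with the
    end of the current one. *)
Lemma concat_loopE k (u : R) : (k < m)%N -> 0 <= u <= 1 ->
  concat_loop es ((k%:R + u) / m%:R) = piece k u.
Proof.
move=> km /andP[u0 u1]; rewrite /concat_loop.
have mR : m%:R != 0 :> R by rewrite pnatr_eq0 -lt0n (leq_ltn_trans _ km).
rewrite mulrC divfK//; have [ue|u1'] := eqVneq u 1.
  rewrite ue natr1 natrK subrr -joint//.
rewrite (@truncn_def _ _ k); last first.
  by rewrite lerDl u0 -natr1 ltrD2l lt_neqAle u1' u1.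
by rewrite addrAC subrr add0r modn_small.
Qed.

Lemma concat_loop_param (t : R) : (0 < m)%N -> 0 <= t <= 1 ->
  exists k u, [/\ (k < m)%N, 0 <= u <= 1 & t = (k%:R + u) / m%:R].
Proof.
move=> m0 /andP[t0 t1].
have mR : 0 < m%:R :> R by rewrite ltr0n.
have mn0 : m%:R != 0 :> R by rewrite gt_eqF.
(* Time 1 is assigned to the end of the last path, as truncation would give the index [m]. *)
have [te|tn] := eqVneq t 1.
  exists m.-1, 1; rewrite prednK// lexx ler01; split=> //.
  by rewrite natr1 prednK// divff.
have T0 : 0 <= m%:R * t by rewrite mulr_ge0// ltW.
have /andP[k1 k2] := truncn_itv T0.
exists (Num.truncn (m%:R * t)), (m%:R * t - (Num.truncn (m%:R * t))%:R); split.
- by rewrite truncn_lt_nat// gtr_pMr// lt_neqAle tn t1.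
- by rewrite subr_ge0 k1 lerBlDr addrC natr1 ltW.
- by rewrite addrC subrK mulrC mulKf.
Qed.

Lemma concat_loop_closed : (0 < m)%N -> concat_loop es 0 = concat_loop es 1.
Proof.
move=> m0; have mR : m%:R != 0 :> R by rewrite pnatr_eq0 -lt0n.
have m1 : (m.-1 < m)%N by rewrite prednK.
have := @concat_loopE 0 0 m0; rewrite addr0 mul0r lexx ler01 => ->//.
have := @concat_loopE m.-1 1 m1; rewrite natr1 prednK// divff// lexx ler01 => ->//.
by rewrite joint// prednK// modnn.
Qed.

(** Two times closer than [1 / m] lie on the same path or on consecutive ones; passing through the
    joint costs the factor 2. *)
Lemma concat_loop_fine (eta r : R) : (0 < m)%N -> 0 < r ->
  (forall k, (k < m)%N -> fine_at eta r (piece k)) ->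
  fine_at (Num.min eta 1 / m%:R) (2 * r) (concat_loop es).
Proof.
move=> m0 r0 fk x y x01 y01.
have mR : 0 < m%:R :> R by rewrite ltr0n.
wlog xy : x y x01 y01 / x <= y.
  move=> H; have [xy|/ltW yx] := leP x y; first exact: H.
  by rewrite distrC => h; rewrite distrC; exact: H.
rewrite distrC ger0_norm ?subr_ge0//.
have [k [u [km u01 xE]]] := concat_loop_param m0 x01.
have [l [w [lm w01 yE]]] := concat_loop_param m0 y01.
rewrite xE yE -mulrBl ltr_pM2r ?invr_gt0// lt_min => /andP[d1 d2].
move: xy; rewrite xE yE ler_pM2r ?invr_gt0// => xy.
rewrite !concat_loopE//.
move: (u01) (w01) => /andP[u0 u1] /andP[w0 w1].
have lk : (l <= k.+1)%N.
  by rewrite -ltnS -(ltr_nat R) -natr1 -natr1; lra.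
case: (ltngtP l k) => [ltlk|ltkl|ekl].
(* As [x <= y], the index of [y] is smaller only when both times denote the same joint. *)
- have : l.+1%:R <= k%:R :> R by rewrite ler_nat.
  rewrite -natr1 => h.
  have eu : u = 0 by lra.
  have ew : w = 1 by lra.
  have el : k = l.+1.
    apply/eqP; rewrite eqn_leq ltlk andbT -(ler_nat R) -natr1; lra.
  rewrite eu ew joint// -el modn_small// subrr normr0; lra.
- have el : l = k.+1 by apply/eqP; rewrite eqn_leq lk.
  move: d1; rewrite el -natr1 => d1.
  rewrite (le_lt_trans (ler_distD (piece k 1) _ _))//.
  have h1 : `|piece k u - piece k 1| < r.
    by apply: fk; rewrite ?lexx ?ler01// distrC ger0_norm; lra.
  have h2 : `|piece k 1 - piece k.+1 w| < r.
    rewrite joint// modn_small -?el//.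
    by apply: fk; rewrite ?lexx ?ler01// distrC ger0_norm; lra.
  lra.
- rewrite -ekl.
  have : `|piece l u - piece l w| < r.
    apply: fk => //; rewrite distrC ger0_norm; move: d1 xy; rewrite ekl; lra.
  lra.
Qed.

Lemma concat_loop_far (r : R) (g : R -> V) : (0 < m)%N ->
  (forall k, (k < m)%N -> far r g (piece k)) -> far r g (concat_loop es).
Proof.
move=> m0 fk x y x01 y01; have [k [u [km u01 ->]]] := concat_loop_param m0 y01.
by rewrite concat_loopE//; exact: fk.
Qed.

End ConcatLoop.

Lemma exists_uniform_radius (R : realType) (I : finType) (P : I -> R -> Prop) :
  (forall i, exists2 r, 0 < r & P i r) ->
  (forall i r r', 0 < r' -> r' <= r -> P i r -> P i r') ->
  exists2 r, 0 < r & forall i, P i r.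
Proof.
move=> Pex Pmono.
suff [r r0 rP] : exists2 r, 0 < r & forall i, i \in enum I -> P i r.
  by exists r => // i; apply: rP; rewrite mem_enum.
elim: (enum I) => [|i s [r r0 IH]]; first by exists 1.
have [r' r'0 Pi] := Pex i; exists (Num.min r r') => [|j].
  by rewrite lt_min r0.
rewrite inE => /orP[/eqP ->|js].
  by apply: Pmono Pi; rewrite ?lt_min ?r0// ge_min lexx orbT.
by apply: Pmono (IH _ js); rewrite ?lt_min ?r0// ge_min lexx.
Qed.

Lemma next_nth_modn (T : eqType) (x0 : T) (c : seq T) k : uniq c ->
  (k < size c)%N -> next c (nth x0 c k) = nth x0 c (k.+1 %% size c).
Proof.
move=> uc kc; rewrite next_nth mem_nth// index_uniq//.
case: c uc kc => // y c uc /=; rewrite ltnS leq_eqVlt => /orP[/eqP ->|kc].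
  by rewrite modnn nth_default.
by rewrite modn_small//=; exact: set_nth_default.
Qed.

(** * Linking numbers as sums over oriented edges *)

Section EdgeSums.
Variables (R : realType) (n : nat) (f : 'rV[R]_n -> 'rV[R]_3) (C : R -> 'rV[R]_3).
Local Notation V := 'rV[R]_3.
Hypothesis hf : {within Kn R n, continuous f}.
Hypothesis hC : closed_curve C.
Hypothesis hdisj : (C @` `[0, 1]) `&` (f @` Kn R n) = set0.

Let edge (i j : 'I_n) : R -> V := f \o @Kn_edge R n i j.

Let edge_in (i j : 'I_n) (t : R) : 0 <= t <= 1 -> Kn R n (Kn_edge i j t).
Proof.
by move=> t01; exists i => //; exists j => //; exists t => //=; rewrite in_itv.
Qed.

Let edge_continuous (i j : 'I_n) : continuous_path (edge i j).
Proof.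
move=> x x01 e e0.
have [delta d0 h] := within_continuous_dist hf (edge_in i j x01) e0.
pose M := `|Kn_vertex R j - Kn_vertex R i| + 1.
have M0 : 0 < M by rewrite ltr_wpDl.
exists (delta / M); first by rewrite divr_gt0.
move=> y y01; rewrite ltr_pdivlMr// => xy.
apply: h; first exact: edge_in.
have -> : Kn_edge i j x - Kn_edge i j y =
    (x - y) *: (Kn_vertex R j - Kn_vertex R i).
  by rewrite /Kn_edge /segment /=; apply/rowP => k; rewrite !mxE; ring.
rewrite normrZ; apply: le_lt_trans xy.
by rewrite ler_wpM2l// /M lerDl.
Qed.

Let C_continuous : continuous_path C.
Proof. by apply: continuous_path_within; case: hC. Qed.

Let edge_disjoint (i j : 'I_n) (x y : R) :
  0 <= x <= 1 -> 0 <= y <= 1 -> C x <> edge i j y.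
Proof.
move=> x01 y01 e; have : ((C @` `[0, 1]) `&` (f @` Kn R n)) (C x).
  split; first by exists x => //=; rewrite in_itv.
  by rewrite e; exists (Kn_edge i j y) => //; exact: edge_in.
by rewrite hdisj.
Qed.

Let edge0 (i j : 'I_n) : edge i j 0 = f (Kn_vertex R i).
Proof. by rewrite /edge /= /Kn_edge /segment subr0 scale0r scale1r addr0. Qed.

Let edge1 (i j : 'I_n) : edge i j 1 = f (Kn_vertex R j).
Proof. by rewrite /edge /= /Kn_edge /segment subrr scale0r scale1r add0r. Qed.

Let edge_rev (i j : 'I_n) (t : R) : edge j i t = edge i j (1 - t).
Proof. by rewrite /edge /= /Kn_edge /segment /= subKr addrC. Qed.

Lemma Lk_edge_sum : exists W : 'I_n -> 'I_n -> int,
  (forall i j, W j i = - W i j) /\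
  forall c, is_cycle c -> Lk C (cycle_curve f c) = \sum_(i <- c) W i (next c i).
Proof.
have [r r0 far_edge] : exists2 r : R, 0 < r & forall ij : 'I_n * 'I_n,
    far r C (edge ij.1 ij.2).
  apply: exists_uniform_radius => [ij|ij a b _ ba h x y x01 y01].
    exact: disjoint_paths_far C_continuous (edge_continuous _ _) (@edge_disjoint _ _).
  by apply: le_lt_trans (h x y x01 y01); rewrite ler_wpM2l.
(* Half of [r], because concatenation doubles the bound. *)
have r20 : 0 < r / 2 by rewrite divr_gt0.
have [eta0 eta00 fine_edge] : exists2 eta : R, 0 < eta &
    forall ij : 'I_n * 'I_n, fine_at eta (r / 2) (edge ij.1 ij.2).
  apply: exists_uniform_radius => [ij|ij a b _ ba h x y x01 y01 xy].
    exact: continuous_path_fine.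
  by apply: h => //; exact: lt_le_trans ba.
have [etaC etaC0 fine_C] := continuous_path_fine C_continuous r0.
(* A cycle has at most [n] edges, so this mesh serves all cycle curves at once; [n.+1] keeps the
   denominator positive. *)
pose eta := Num.min (Num.min eta0 1 / n.+1%:R) etaC.
have eta_gt0 : 0 < eta by rewrite lt_min etaC0 divr_gt0// lt_min eta00 ltr01.
have fC : fine_at eta r C.
  move=> x y x01 y01 xy; apply: fine_C => //; apply: lt_le_trans xy _.
  by rewrite ge_min lexx orbT.
have [N [N0 Neta]] := exists_uniform eta_gt0.
have NR : 0 < N%:R :> R by rewrite ltr0n.
pose E i j l := edge i j (l%:R / N%:R).
(* All sample points of [C] and of every edge, so that one generic direction serves all cycles. *)
pose A := map C (0 :: uniform_partition R N) ++
  [seq E p.1 p.2 l | p <- enum {: 'I_n * 'I_n}, l <- iota 0 N.+1].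
have EA i j l : (l <= N)%N -> E i j l \in A.
  move=> lN; rewrite mem_cat; apply/orP; right.
  by apply/allpairsP; exists ((i, j), l); rewrite mem_enum mem_iota.
have [v [gen _]] := generic_exists A [::].
pose W i j := \sum_(e <- inscribed C (uniform_partition R N)) \sum_(0 <= l < N)
  crossing_sign v e (E i j l, E i j l.+1).
exists W; split.
  move=> i j; rewrite /W -sumrN; apply: eq_bigr => -[a b] _.
  rewrite -sumrN big_nat_rev /= !big_nat; apply: eq_bigr => l /andP[_ lN].
  rewrite -crossing_sign_rev; congr crossing_sign.
  (* The reversed edge has the same sample points in the opposite order. *)
  have Erev k : (k <= N)%N -> E j i (N - k)%N = E i j k.
    move=> kN; rewrite /E edge_rev natrB// mulrBl divff ?gt_eqF//.
    by rewrite opprB addrC subrK.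
  by rewrite add0n -(Erev l.+1)// -(Erev l)// 1?ltnW// subnSK.
move=> c [c3 uc].
have x0 : 'I_n by case: c c3 {uc}.
set es := [seq edge i (next c i) | i <- c].
have ccE : cycle_curve f c = concat_loop es by [].
have sz : size es = size c by rewrite size_map.
have m0 : (0 < size es)%N by rewrite sz; exact: leq_trans c3.
have pieceE k : (k < size es)%N ->
    nth (fun=> 0) es k = edge (nth x0 c k) (next c (nth x0 c k)).
  by rewrite sz => kc; rewrite (nth_map x0).
have joint k : (k < size es)%N ->
    nth (fun=> 0) es k 1 = nth (fun=> 0) es (k.+1 %% size es)%N 0.
  move=> km; rewrite !pieceE// ?ltn_pmod// edge0 edge1 sz.
  by rewrite next_nth_modn// -sz.
have fcc : fine_at eta r (cycle_curve f c).
  have := concat_loop_fine joint m0 r20 (eta := eta0).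
  rewrite ccE => h x y x01 y01 xy.
  have -> : r = 2 * (r / 2) by rewrite mulrC divfK// pnatr_eq0.
  apply: h => // [k km|]; first by rewrite pieceE//; exact: (fine_edge (_, _)).
  apply: lt_le_trans xy _; rewrite ge_min; apply/orP; left.
  apply: ler_wpM2l; first by rewrite le_min ler01 ltW.
  rewrite lef_pV2 ?posrE ?ltr0n// ler_nat sz.
  have := max_card (mem c); rewrite (card_uniqP uc) card_ord => cn.
  exact: leq_trans cn (leqnSn n).
have farcc : far r C (cycle_curve f c).
  by apply: concat_loop_far => // k km; rewrite pieceE//; exact: (far_edge (_, _)).
have cc01 : cycle_curve f c 0 = cycle_curve f c 1.
  exact: concat_loop_closed.
have C01 : C 0 = C 1 by case: hC.
(* With [M] steps, time [(k * N + l) / M] on the cycle curve is time [l / N] on its [k]-th edge. *)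
pose M := (size c * N)%N.
have M0 : (0 < M)%N by rewrite muln_gt0 N0 -sz m0.
have fN : fine_partition eta (uniform_partition R N).
  exact: uniform_partition_fine.
have fM : fine_partition eta (uniform_partition R M).
  apply: uniform_partition_fine => //; apply: le_lt_trans Neta.
  rewrite lef_pV2 ?posrE ?ltr0n// ler_nat leq_pmull// -sz//.
have atE k l : (k < size c)%N -> (l <= N)%N ->
    cycle_curve f c ((k * N + l)%:R / M%:R) = E (nth x0 c k) (next c (nth x0 c k)) l.
  move=> kc lN; rewrite /E -pieceE ?sz// -(concat_loopE joint) ?sz//; last first.
    by rewrite divr_ge0//= ler_pdivrMr// mul1r ler_nat.
  rewrite ccE; congr (concat_loop es _); rewrite natrD !natrM.
  field; rewrite !gt_eqF//= ltr0n -sz//.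
have mA : {subset map (cycle_curve f c) (0 :: uniform_partition R M) <= A}.
  move=> p; rewrite [map _ _]/= inE => /orP[/eqP ->|].
    have := @atE 0%N 0%N; rewrite mul0n addn0 mul0r -sz => ->//.
    exact: EA.
  rewrite /uniform_partition -map_comp => /mapP[i]; rewrite mem_iota add0n /=.
  move=> iM ->.
  have kc : (i %/ N < size c)%N by rewrite ltn_divLR.
  have lN : ((i %% N).+1 <= N)%N by rewrite ltn_pmod.
  by rewrite /= {1}(divn_eq i N) -addnS atE//; exact: EA.
rewrite (LkE eta_gt0 fC fcc farcc C01 cc01 fN fM (v := v)); last first.
  apply: (generic_regular_projection fC fcc farcc fN fM gen) => //.
  by move=> p pC; rewrite mem_cat pC.
rewrite /W exchange_big /crossing_number /=; apply: eq_bigr => e _.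
rewrite /inscribed pairmap_uniform big_map.
rewrite -{1}[M]subn0 -/(index_iota 0 M) big_nat_mul.
rewrite (big_nth x0) !big_mkord; apply: eq_bigr => k _.
rewrite mulSn -{1}[(k * N)%N]add0n big_addn addnK.
rewrite !big_nat; apply: eq_bigr => l /andP[_ lN].
by rewrite addnC -addnS !atE// ltnW.
Qed.

End EdgeSums.

(** * Combinatorics of the edge cochain *)

Section EdgeCochains.
Variables (n : nat) (W : 'I_n -> 'I_n -> int).
Hypothesis Wopp : forall i j, W j i = - W i j.

Definition cycle_sum (w : 'I_n -> 'I_n -> int) (c : seq 'I_n) : int :=
  \sum_(i <- c) w i (next c i).

Lemma map_next (c : seq 'I_n) : uniq c -> [seq next c i | i <- c] = rot 1 c.
Proof.
case: c => // x s uc; apply: (@eq_from_nth _ x); first by rewrite size_map size_rot.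
move=> i; rewrite size_map => ic.
rewrite (nth_map x)// next_nth_modn// rot1_cons nth_rcons /=.
move: ic; rewrite /= ltnS leq_eqVlt => /orP[/eqP->|il].
  by rewrite modnn ltnn eqxx.
by rewrite modn_small// il.
Qed.

Lemma map_zip_rcons (w : 'I_n -> 'I_n -> int) x z s :
  [seq w p.1 p.2 | p <- zip (x :: s) (rcons s z)] = pairmap w x (rcons s z).
Proof. by elim: s x => //= y s IH x; rewrite IH. Qed.

Lemma cycle_sum_cons w x s : uniq (x :: s) ->
  cycle_sum w (x :: s) = \sum_(j <- pairmap w x (rcons s x)) j.
Proof.
move=> uc; rewrite /cycle_sum -[LHS](big_map (fun i => w i (next (x :: s) i)) xpredT id).
congr bigop.
have -> : [seq w i (next (x :: s) i) | i <- x :: s] =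
    [seq w p.1 p.2 | p <- zip (x :: s) [seq next (x :: s) i | i <- x :: s]].
  by move: (next _); elim: (x :: s) => //= a t IH g; rewrite IH.
rewrite map_next// rot1_cons.
exact: map_zip_rcons.
Qed.

(** [next] permutes the vertices of the cycle, so the values of [phi] cancel. *)
Lemma cycle_sum_coboundary (w : 'I_n -> 'I_n -> int) (phi : 'I_n -> int) c :
  uniq c -> cycle_sum (fun x y => w x y + (phi y - phi x)) c = cycle_sum w c.
Proof.
move=> uc; rewrite /cycle_sum big_split /= sumrB.
rewrite -[X in _ + (X - _)](big_map (next c) xpredT phi) map_next//.
by rewrite (perm_big _ (permEl (perm_rot 1 c))) subrr addr0.
Qed.

Lemma cycle_sum_rot (w : 'I_n -> 'I_n -> int) c k : uniq c ->
  cycle_sum w (rot k c) = cycle_sum w c.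
Proof.
move=> uc; rewrite /cycle_sum (perm_big c) /=; last by rewrite perm_rot.
by apply: eq_bigr => i _; rewrite next_rot.
Qed.

Lemma cycle_sum3 (w : 'I_n -> 'I_n -> int) a b c : uniq [:: a; b; c] ->
  cycle_sum w [:: a; b; c] = w a b + w b c + w c a.
Proof.
by move=> u; rewrite cycle_sum_cons//= !big_cons big_nil addr0 !addrA.
Qed.

(** The sum of [W] around the triangle on [p], [x], [y]: a cohomologous cochain that vanishes on the
    edges at [p]. *)
Definition gauge p x y : int := W x y + (- W p y - - W p x).

Lemma cycle_sum_gauge p c : uniq c -> cycle_sum (gauge p) c = cycle_sum W c.
Proof. exact: cycle_sum_coboundary. Qed.

Lemma gauge_opp p x y : gauge p y x = - gauge p x y.
Proof. by rewrite /gauge Wopp; ring. Qed.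

Lemma W_diag x : W x x = 0.
Proof. by have := Wopp x x; lia. Qed.

Lemma gauge_base p x : gauge p p x = 0.
Proof. by rewrite /gauge W_diag; ring. Qed.

Lemma gauge_base_r p x : gauge p x p = 0.
Proof. by rewrite gauge_opp gauge_base oppr0. Qed.

Lemma gauge_diag p x : gauge p x x = 0.
Proof. by rewrite /gauge W_diag; ring. Qed.

Lemma cycle_sum_path p y s : uniq [:: p, y & s] ->
  cycle_sum W [:: p, y & s] = \sum_(j <- pairmap (gauge p) y s) j.
Proof.
move=> u; rewrite -(cycle_sum_gauge p)// cycle_sum_cons//= big_cons gauge_base add0r.
rewrite -cats1 pairmap_cat big_cat /= big_seq1.
by rewrite gauge_base_r addr0.
Qed.

(** * Star cochains *)

Definition star_cochain (O I : {set 'I_n}) x y : int :=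
  (x \in O)%:Z * (y \in I)%:Z - (y \in O)%:Z * (x \in I)%:Z.

Lemma star_partition p (O I : {set 'I_n}) : is_star p O I ->
  [/\ p \notin O, p \notin I, forall x, x \in O -> x \notin I &
    forall x, x != p -> x \notin O -> x \in I].
Proof.
move=> [_ _ OI OIC].
have pOI : p \notin O :|: I by rewrite OIC !inE eqxx.
move: pOI; rewrite !inE => /norP[pO pI]; split=> // [x xO|x xp xO].
  by apply/negP => xI; have := finset.in_set0 x; rewrite -OI !inE xO xI.
by have : x \in O :|: I; [rewrite OIC !inE|rewrite !inE (negPf xO)].
Qed.

Lemma star_triangles p (O I : {set 'I_n}) (T : seq 'I_n) : is_star p O I ->
  size T = 3%N -> uniq T ->
  [/\ in_star p O I T -> cycle_sum (star_cochain O I) T = 1,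
      in_star p O I (rev T) -> cycle_sum (star_cochain O I) T = -1 &
      ~ in_star p O I T -> ~ in_star p O I (rev T) ->
        cycle_sum (star_cochain O I) T = 0].
Proof.
move=> st sT uT; have [pO pI dO cI] := star_partition st.
have one q r : q \in O -> r \in I -> uniq [:: p; q; r] /\
    cycle_sum (star_cochain O I) [:: p; q; r] = 1.
  move=> qO rI; have qI := dO _ qO.
  have rO : r \notin O by apply/negP => /dO; rewrite rI.
  have u : uniq [:: p; q; r].
    rewrite /= !inE negb_or andbT -andbA; apply/and3P; split.
    - by apply/eqP => e; rewrite e qO in pO.
    - by apply/eqP => e; rewrite e rI in pI.
    - by apply/eqP => e; rewrite e rI in qI.
  split=> //; rewrite cycle_sum3// /star_cochain.
  by rewrite qO rI (negPf pO) (negPf pI) (negPf qI) (negPf rO).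
case: T sT uT => // a [//|b [//|c [|//]]] _ uT.
have urev : uniq [:: c; b; a] by rewrite -rev_uniq.
have revE : cycle_sum (star_cochain O I) [:: a; b; c] =
    - cycle_sum (star_cochain O I) [:: c; b; a].
  rewrite !cycle_sum3// /star_cochain; ring.
split.
- move=> [q [r [k [qO rI ->]]]]; have [u <-] := one q r qO rI.
  exact: cycle_sum_rot.
- rewrite revE => -[q [r [k [qO rI]]]]; rewrite /rev /= => ->.
  by have [u <-] := one q r qO rI; rewrite cycle_sum_rot.
move=> nT nR; rewrite cycle_sum3//.
have H x y z k : rot k [:: x; y; z] = [:: a; b; c] -> x = p ->
    ~ (y \in O /\ z \in I).
  by move=> e xp [yO zI]; apply: nT; exists y, z, k; rewrite -xp.
have H' x y z k : rot k [:: x; y; z] = [:: c; b; a] -> x = p ->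
    ~ (y \in O /\ z \in I).
  by move=> e xp [yO zI]; apply: nR; exists y, z, k; rewrite -xp.
have cls x : (x = p /\ (x \in O = false /\ x \in I = false)) \/
    (x <> p /\ x \in O = ~~ (x \in I)).
  have [->|xp] := eqVneq x p; first by left; rewrite (negPf pO) (negPf pI).
  right; split; first exact/eqP.
  by have [/dO -> //|/(cI _ xp) ->] := boolP (x \in O).
have h1 := H a b c 0%N erefl; have h2 := H b c a 2%N erefl.
have h3 := H c a b 1%N erefl.
have h1' := H' a c b 1%N erefl; have h2' := H' b a c 2%N erefl.
have h3' := H' c b a 0%N erefl.
move: uT; rewrite /= !inE negb_or andbT => /andP[/andP[ab ac] bc].
have fin (y z : 'I_n) : ~ (y \in O /\ z \in I) -> ~ (z \in O /\ y \in I) ->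
    star_cochain O I y z = 0.
  rewrite /star_cochain; case: (y \in O) (y \in I) (z \in O) (z \in I).
  by case=> [] [] [] // k1 k2; exfalso; first [exact: k1|exact: k2].
  by case=> [] [] [] // k1 k2; exfalso; first [exact: k1|exact: k2].
have base y : star_cochain O I p y = 0 /\ star_cochain O I y p = 0.
  by rewrite /star_cochain (negPf pO) (negPf pI) !mul0r !mulr0 subrr.
case: (cls a) => [[ap _]|[ap aE]].
  rewrite ap; have [-> _] := base b; have [_ ->] := base c.
  by rewrite add0r addr0; apply: fin; [exact: h1|exact: h1'].
case: (cls b) => [[bp _]|[bp bE]].
  rewrite bp; have [_ ->] := base a; have [-> _] := base c.
  by rewrite !add0r; apply: fin; [exact: h2|exact: h2'].
case: (cls c) => [[cp _]|[cp cE]].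
  rewrite cp; have [_ ->] := base b; have [-> _] := base a.
  by rewrite !addr0; apply: fin; [exact: h3|exact: h3'].
(* Away from [p] the cochain is the coboundary of the indicator of [I], so it sums to 0. *)
rewrite /star_cochain aE bE cE.
by case: (a \in I); case: (b \in I); case: (c \in I).
Qed.

Lemma star_of_cohomologous p (O I : {set 'I_n}) (w : 'I_n -> 'I_n -> int)
    (phi : 'I_n -> int) : is_star p O I ->
  (forall c, uniq c -> cycle_sum w c = cycle_sum W c) ->
  (forall x y, star_cochain O I x y = w x y + (phi y - phi x)) ->
  forall T : seq 'I_n, size T = 3%N -> uniq T ->
  [/\ in_star p O I T -> cycle_sum W T = 1,
      in_star p O I (rev T) -> cycle_sum W T = -1 &
      ~ in_star p O I T -> ~ in_star p O I (rev T) -> cycle_sum W T = 0].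
Proof.
move=> st wW E T sT uT; have := star_triangles st sT uT.
suff -> : cycle_sum (star_cochain O I) T = cycle_sum W T by [].
rewrite -wW// -(cycle_sum_coboundary w phi uT).
by apply: eq_bigr => i _; rewrite E.
Qed.

Lemma weak_implies_star :
  (exists2 c, is_cycle c & cycle_sum W c != 0) ->
  (forall c, is_cycle c -> `|cycle_sum W c| <= 1) ->
  exists p O I, is_star p O I /\ forall T : seq 'I_n, size T = 3%N -> uniq T ->
  [/\ in_star p O I T -> cycle_sum W T = 1,
      in_star p O I (rev T) -> cycle_sum W T = -1 &
      ~ in_star p O I T -> ~ in_star p O I (rev T) -> cycle_sum W T = 0].
Proof.
move=> [c0 [c03 uc0] c0n] weak.
have [p hp] : exists p, c0 = p :: behead c0 by case: c0 c03 {uc0 c0n} => // p s; exists p.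
pose w := gauge p.
have wopp x y : w y x = - w x y by exact: gauge_opp.
have path_le y s : uniq [:: p, y & s] -> (0 < size s)%N ->
    `|\sum_(j <- pairmap w y s) j| <= 1.
  by move=> u s0; rewrite -cycle_sum_path//; apply: weak; split.
have distinct x y : w x y != 0 -> uniq [:: p; x; y].
  move=> wxy; rewrite /= !inE negb_or andbT -andbA; apply/and3P; split.
  - by apply: contraNneq wxy => <-; rewrite /w gauge_base.
  - by apply: contraNneq wxy => <-; rewrite /w gauge_base_r.
  - by apply: contraNneq wxy => ->; rewrite /w gauge_diag.
have w_le x y : `|w x y| <= 1.
  have [->|/distinct u] := eqVneq (w x y) 0; first by [].
  by have := path_le x [:: y] u isT; rewrite /= big_seq1.
(* Otherwise the cycle on [p], [x], [y], [z] has sum 2. *)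
have no_path x y z : w x y = 1 -> w y z = 1 -> False.
  move=> xy yz.
  have u1 := distinct x y; have u2 := distinct y z.
  move: u1 u2; rewrite xy yz /= !inE !negb_or !andbT => /(_ isT) + /(_ isT).
  move=> /andP[/andP[px py] nxy] /andP[/andP[_ pz] nyz].
  have xz : x != z.
    by apply/eqP => e; have := wopp x y; rewrite xy e yz.
  have := path_le x [:: y; z]; rewrite /= !inE !negb_or px py pz nxy xz nyz.
  by rewrite !big_cons big_nil xy yz => /(_ isT isT).
pose O : {set 'I_n} := finset (fun x => [exists y, w x y == 1]).
pose I : {set 'I_n} := finset (fun y => [exists x, w x y == 1]).
have inO x : reflect (exists y, w x y = 1) (x \in O).
  by rewrite finset.in_set; apply: (iffP existsP) => -[y /eqP]; exists y => //; exact/eqP.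
have inI y : reflect (exists x, w x y = 1) (y \in I).
  by rewrite finset.in_set; apply: (iffP existsP) => -[x /eqP]; exists x => //; exact/eqP.
clearbody O I.
have dOI x : x \in O -> x \in I -> False.
  by move=> /inO[y xy] /inI[z zx]; exact: no_path zx xy.
have neOI x y : x \in O -> y \in I -> x != y.
  by move=> xO yI; apply/eqP => e; apply: (dOI x) => //; rewrite e.
have pO : p \notin O by apply/inO => -[y]; rewrite /w gauge_base.
have pI : p \notin I by apply/inI => -[y]; rewrite /w gauge_base_r.
have nep x (A : {set 'I_n}) : x \in A -> p \notin A -> p != x.
  by move=> xA pA; apply: contraNneq pA => ->.
have wOI x y : w x y = 1 -> x \in O /\ y \in I.
  by move=> xy; split; [apply/inO; exists y|apply/inI; exists x].
(* Edges of value 1 leaving [x] and entering [y] are joined by the edge from [y] to [x]; the bound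
   then forces the value -1 on that edge. *)
have complete x y : x \in O -> y \in I -> w x y = 1.
  move=> xO yI; have [y' xy'] := inO _ xO; have [x' x'y] := inI _ yI.
  have [yy|yy] := eqVneq y' y; first by rewrite -yy.
  have [xx|xx] := eqVneq x' x; first by rewrite -xx.
  have [x'O _] := wOI _ _ x'y; have [_ y'I] := wOI _ _ xy'.
  have u : uniq [:: p; x'; y; x; y'].
    rewrite /= !inE !negb_or (nep _ _ xO pO) (nep _ _ x'O pO) (nep _ _ yI pI).
    rewrite (nep _ _ y'I pI) (neOI x' y)// xx (neOI x' y')// (neOI x y')//.
    by rewrite [y == x]eq_sym (neOI x y)// [y == y']eq_sym yy.
  (* The sum over this cycle is [2 + w y x]. *)
  have := path_le _ _ u isT.
  rewrite /= !big_cons big_nil x'y xy' (wopp x y).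
  by move: (w x y) (w_le x y) => a ha; clear -ha; lia.
(* Every value is -1, 0 or 1, and nonzero values occur only between [O] and [I]. *)
have wE x y : star_cochain O I x y = w x y.
  rewrite /star_cochain.
  have [xO|xO] := boolP (x \in O); have [yI|yI] := boolP (y \in I).
  - rewrite (complete x y)//.
    by have [/dOI/(_ yI)//|yO] := boolP (y \in O).
  - have [xI|xI] := boolP (x \in I); first by have := dOI _ xO xI.
    have : w x y <> 1 by move=> /wOI[_ yI']; rewrite yI' in yI.
    have : w y x <> 1 by move=> /wOI[_ xI']; rewrite xI' in xI.
    by rewrite wopp; move: (w x y) (w_le x y) => a ha; clear -ha; case: (y \in O) => /=; lia.
  - have [yO|yO] := boolP (y \in O); first by have := dOI _ yO yI.
    have : w x y <> 1 by move=> /wOI[xO' _]; rewrite xO' in xO.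
    have : w y x <> 1 by move=> /wOI[yO' _]; rewrite yO' in yO.
    by rewrite wopp; move: (w x y) (w_le x y) => a ha; clear -ha; case: (x \in I) => /=; lia.
  have [yO|yO] := boolP (y \in O); have [xI|xI] := boolP (x \in I).
  - by rewrite -[w x y]opprK -wopp complete.
  - have : w x y <> 1 by move=> /wOI[xO' _]; rewrite xO' in xO.
    have : w y x <> 1 by move=> /wOI[_ xI']; rewrite xI' in xI.
    by rewrite wopp; move: (w x y) (w_le x y) => a ha; clear -ha; lia.
  - have : w x y <> 1 by move=> /wOI[xO' _]; rewrite xO' in xO.
    have : w y x <> 1 by move=> /wOI[yO' _]; rewrite yO' in yO.
    by rewrite wopp; move: (w x y) (w_le x y) => a ha; clear -ha; lia.
  - have : w x y <> 1 by move=> /wOI[xO' _]; rewrite xO' in xO.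
    have : w y x <> 1 by move=> /wOI[yO' _]; rewrite yO' in yO.
    by rewrite wopp; move: (w x y) (w_le x y) => a ha; clear -ha; lia.
(* The linked cycle keeps its nonzero sum under the gauge, so some edge, up to reversal, has value
   1. *)
have [q [r qr]] : exists q r, w q r = 1.
  apply/not_existsP => no; move: c0n; rewrite -(cycle_sum_gauge p)//.
  rewrite /cycle_sum big1 ?eqxx// => x _.
  have n1 u v : w u v <> 1 by move=> uv; apply: (no u); exists v.
  have := n1 x (next c0 x); have := n1 (next c0 x) x.
  rewrite wopp -/w; have := w_le x (next c0 x); lia.
have [qO rI] := wOI _ _ qr.
have sumW c : uniq c -> cycle_sum w c = cycle_sum W c by exact: cycle_sum_gauge.
have O0 : (0 < #|O|)%N by apply/card_gt0P; exists q.
have I0 : (0 < #|I|)%N by apply/card_gt0P; exists r.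
have [[z [zp zO zI]]|noz] :=
    pselect (exists z, [/\ z != p, z \notin O & z \notin I]); last first.
  have st : is_star p O I.
    split=> //.
      apply/setP => x; rewrite !finset.in_setI finset.in_set0.
      by apply/negP => /andP[/dOI].
    apply/setP => x; rewrite !inE; have [->|xp] := eqVneq x p.
      by rewrite (negPf pO) (negPf pI).
    apply/negPn/negP => /norP[xO xI]; apply: noz; by exists x.
  exists p, O, I; split=> //.
  by apply: (star_of_cohomologous (w := w) (phi := fun=> 0) st) => // x y;
    rewrite wE subrr addr0.
have wz x : w x z = 0 /\ w z x = 0.
  by rewrite -!wE /star_cochain (negPf zO) (negPf zI) !mul0r !mulr0 subrr.
(* A vertex [z] in neither part connects two disjoint edges of value 1 through edges of value 0. *)
have thin q' r' : q' \in O -> r' \in I -> q != q' -> r != r' -> False.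
  move=> q'O r'I qq rr.
  have nez t (A : {set 'I_n}) : t \in A -> z \notin A -> z != t.
    by move=> tA zA; apply: contraNneq zA => ->.
  have u : uniq [:: p; q; r; z; q'; r'].
    rewrite /= !inE !negb_or (nep q O)// (nep r I)// (nep q' O)// (nep r' I)//.
    rewrite [p == z]eq_sym zp (neOI q r)// (neOI q r')// (neOI q' r')// qq rr.
    rewrite (nez q' O)// (nez r' I)// [q == z]eq_sym (nez q O)//.
    by rewrite [r == z]eq_sym (nez r I)// [r == q']eq_sym (neOI q' r).
  (* The sum over this cycle is 2. *)
  have := path_le _ _ u isT.
  by rewrite /= !big_cons big_nil qr (wz r).1 (wz q').2 (complete q' r').
have [Oq|] := pselect (O = finset.set1 q).
  have rO : r \notin O by apply/negP => /dOI/(_ rI).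
  have qI : q \notin I by apply/negP => /(dOI q qO).
  (* The apex moves to [q]: subtracting the coboundary of the indicator of [I] clears the edges at
     [q] and gives value 1 to the edges from [I] to the remaining vertices, [p] among them. *)
  pose I' : {set 'I_n} := ~: (q |: I).
  have st : is_star q I I'.
    split=> //.
    - apply/card_gt0P; exists p; rewrite /I' !inE negb_or pI andbT.
      by rewrite (nep q O).
    - apply/setP => x; rewrite /I' !inE; case: (x \in I) => //=.
      by rewrite orbT.
    apply/setP => x; rewrite /I' !inE; have [->|xq] := eqVneq x q.
      by rewrite (negPf qI).
    by case: (x \in I).
  exists q, I, I'; split=> //.
  apply: (star_of_cohomologous (w := w) (phi := fun x => - (x \in I)%:Z) st) => // x y.
  rewrite -wE /star_cochain /I' Oq !inE.
  have [->|xq] := eqVneq x q; have [->|yq] := eqVneq y q;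
    by rewrite ?(negPf qI); case: (x \in I); case: (y \in I).
move=> Oq; have [q' q'O qq'] : exists2 q', q' \in O & q != q'.
  apply/exists2P/not_existsP => no; apply: Oq; apply/setP => x; rewrite inE.
  apply/idP/eqP => [xO|->//]; apply/eqP/negPn/negP => xq; apply: (no x).
  by split=> //; rewrite eq_sym.
have Ir : I = finset.set1 r.
  apply/setP => x; rewrite inE; apply/idP/eqP => [xI|->//].
  by apply/eqP/negPn/negP => xr; apply: (thin q' x); rewrite // eq_sym.
have rO : r \notin O by apply/negP => /dOI/(_ rI).
(* Symmetrically, adding the coboundary of the indicator of [O] moves the apex to [r]. *)
pose O' : {set 'I_n} := ~: (r |: O).
have st : is_star r O' O.
  split=> //.
  - apply/card_gt0P; exists p; rewrite /O' !inE negb_or pO andbT.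
    by rewrite (nep r I).
  - apply/setP => x; rewrite /O' !inE.
    by case: (x \in O); rewrite ?orbT ?andbF.
  apply/setP => x; rewrite /O' !inE; have [->|xr] := eqVneq x r.
    by rewrite (negPf rO).
  by case: (x \in O).
exists r, O', O; split=> //.
apply: (star_of_cohomologous (w := w) (phi := fun x => (x \in O)%:Z) st) => // x y.
rewrite -wE /star_cochain /O' Ir !inE.
have [->|xr] := eqVneq x r; have [->|yr] := eqVneq y r;
  by rewrite ?(negPf rO); case: (x \in O); case: (y \in O).
Qed.

(** Gauged at [p], the cochain is the coboundary of the indicator of [I] away from [p]. A cycle
    avoiding [p] has sum 0; one through [p] telescopes to a difference of two indicator values. *)
Lemma star_implies_weak p (O I : {set 'I_n}) : is_star p O I ->
  (forall T : seq 'I_n, size T = 3%N -> uniq T ->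
  [/\ in_star p O I T -> cycle_sum W T = 1,
      in_star p O I (rev T) -> cycle_sum W T = -1 &
      ~ in_star p O I T -> ~ in_star p O I (rev T) -> cycle_sum W T = 0]) ->
  forall c, is_cycle c -> `|cycle_sum W c| <= 1.
Proof.
move=> st hT c [c3 uc]; have [pO pI dO cI] := star_partition st.
pose phi x : int := (x \in I)%:Z.
have gE x y : x != p -> y != p -> gauge p x y = phi y - phi x.
  move=> xp yp; have [->|xy] := eqVneq x y; first by rewrite gauge_diag subrr.
  have u : uniq [:: p; x; y].
    by rewrite /= !inE negb_or xy ![p == _]eq_sym xp yp.
  have u2 : uniq [:: p; y; x].
    by rewrite /= !inE negb_or ![p == _]eq_sym xp yp eq_sym xy.
  have gW : gauge p x y = cycle_sum W [:: p; x; y].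
    by rewrite cycle_sum_path//= big_seq1.
  have sE := star_triangles st (T := [:: p; x; y]) erefl u.
  have [h1 h2 h3] := hT [:: p; x; y] erefl u.
  have [h1' h2' h3'] := sE.
  have -> : gauge p x y = cycle_sum (star_cochain O I) [:: p; x; y].
    rewrite gW.
    have [a|a] := pselect (in_star p O I [:: p; x; y]); first by rewrite h1// h1'.
    have [b|b] := pselect (in_star p O I (rev [:: p; x; y])).
      by rewrite h2// h2'.
    by rewrite h3// h3'.
  rewrite cycle_sum3// /star_cochain (negPf pO) (negPf pI) /phi.
  have oE z : z != p -> (z \in O) = ~~ (z \in I).
    by move=> zp; have [/dO -> //|/(cI _ zp) ->] := boolP (z \in O).
  by rewrite !oE//; case: (x \in I); case: (y \in I).
have phi01 x : 0 <= phi x <= 1 by rewrite /phi; case: (x \in I).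
have [pc|pc] := boolP (p \in c); last first.
  rewrite -(cycle_sum_gauge p)// /cycle_sum.
  rewrite -[X in `|X| <= _](_ : cycle_sum (fun x y => 0 + (phi y - phi x)) c = _).
    by rewrite cycle_sum_coboundary// /cycle_sum big1 ?normr0.
  rewrite /cycle_sum !big_seq; apply: eq_bigr => i ic; rewrite add0r gE//.
    by apply: contraNneq pc => <-.
  by apply: contraNneq pc => <-; rewrite mem_next.
have [k s cE] := rot_to pc.
rewrite -(cycle_sum_rot W k uc) cE.
have : uniq (p :: s) by rewrite -cE rot_uniq.
have : (3 <= size (p :: s))%N by rewrite -cE size_rot.
case: s {cE} => // y s _ u; rewrite cycle_sum_path//.
have -> : \sum_(j <- pairmap (gauge p) y s) j =
    \sum_(j <- pairmap (fun a b => phi b - phi a) y s) j.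
  have : all (fun x => x != p) (y :: s).
    apply/allP => x xs; apply: contraTneq u => xp.
    by rewrite /= -xp -/(_ \in _) xs.
  elim: s y {u} => [|z s IH] y /=; first by rewrite !big_nil.
  by move=> /and3P[yp zp sp]; rewrite !big_cons gE// IH//= zp.
rewrite telescope_pairmap.
move: (phi01 (last y s)) (phi01 y); move: (phi (last y s)) (phi y) => a b.
by clear; lia.
Qed.

End EdgeCochains.

(** * Transfer from cochains to linking numbers *)

Theorem theorem2p1 (R : realType) (n : nat) (hn : (3 <= n)%N)
    (f : 'rV[R]_n -> 'rV[R]_3) (hf : Kn_embedding f)
    (C : R -> 'rV[R]_3) (hC : simple_closed_curve C)
    (hdisj : (C @` `[0, 1]) `&` (f @` Kn R n) = set0)
    (hlink : links_some_cycle f C) :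
  weakly_links f C <-> links_in_a_star f C.
Proof.
have [cf _] := hf; have [cC _] := hC.
have [W [Wopp LkW]] := Lk_edge_sum cf cC hdisj.
have LkT T : size T = 3%N -> uniq T ->
    Lk C (cycle_curve f T) = cycle_sum W T.
  by move=> sT uT; rewrite LkW//; split=> //; rewrite sT.
split=> [[_ weak]|[p [OO [II [st hT]]]]].
  have linked : exists2 c, is_cycle c & cycle_sum W c != 0.
    by have [c hc lc] := hlink; exists c => //; rewrite /cycle_sum -LkW.
  have weakW c : is_cycle c -> `|cycle_sum W c| <= 1.
    move=> hc; have := weak c hc; rewrite /strongly_linked LkW// -/(cycle_sum W c).
    by move: (cycle_sum W c) => a; clear; lia.
  have [p [OO [II [st hT]]]] := weak_implies_star Wopp linked weakW.
  exists p, OO, II; split=> // T sT uT; rewrite LkT//; exact: hT.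
(* The existence of a linked cycle is the hypothesis [hlink]; only the bound remains. *)
split=> // c hc; rewrite /strongly_linked LkW// -/(cycle_sum W c).
have : `|cycle_sum W c| <= 1.
  apply: (star_implies_weak Wopp st) hc => T sT uT.
  by rewrite -LkT//; exact: hT.
by move: (cycle_sum W c) => a; clear; lia.
Qed.
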